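(* Let $\widetilde{G}$ be a connected mixed graph. Then $p^{+}(\widetilde{G})= m(\widetilde{G})+c(\widetilde{G})$ if and only if the following three conditions all hold: (i) any two cycles of $\widetilde{G}$ share no common vertices; (ii) for each cycle $\widetilde{C_{q}}$ of $\widetilde{G}$ (with $q$ vertices), $q$ is odd, $\sigma(\widetilde{C_{q}})$ is even and $|\sigma(\widetilde{C_{q}})-q| \equiv 1 \pmod 4$; (iii) $m(T_{\widetilde{G}})=m([T_{\widetilde{G}}])$.
   Context: All graphs are finite, without loops or multiple edges. A mixed graph $\widetilde{G}$ is obtained from an undirected graph $G$ (its underlying graph) by orienting some of the edges of $G$; cycles and connectedness of $\widetilde{G}$ refer to $G$. If $\widetilde{G}$ has vertices $v_1,\dots,v_n$, its Hermitian adjacency matrix is the $n\times n$ matrix $H(\widetilde{G})=(h_{kl})$ with $h_{kl}=-h_{lk}=\mathbf{i}$ (the imaginary unit) if there is an arc from $v_k$ to $v_l$, $h_{kl}=h_{lk}=1$ if $v_k,v_l$ are joined by an undirected edge, and $h_{kl}=0$ otherwise. $H(\widetilde{G})$ is Hermitian; $p^{+}(\widetilde{G})$ denotes the number of positive eigenvalues of $H(\widetilde{G})$ (with multiplicity). The matching number $m(\cdot)$ is the maximum cardinality of a matching of the underlying graph, and $c(\widetilde{G})=|E(G)|-|V(G)|+\omega(G)$, where $\omega(G)$ is the number of connected components of $G$. The signature of a mixed cycle $\widetilde{C}$ is $\sigma(\widetilde{C})=|f-b|$, where $f$ and $b$ are the numbers of forward-oriented and backward-oriented arcs of $\widetilde{C}$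 with respect to a traversal of the cycle (undirected edges are not counted). When any two distinct cycles of $\widetilde{G}$ are vertex disjoint, $T_{\widetilde{G}}$ denotes the forest obtained by contracting each cycle of $\widetilde{G}$ into a vertex (called a cyclic vertex), and $[T_{\widetilde{G}}]$ denotes the subgraph of $T_{\widetilde{G}}$ induced by all non-cyclic vertices. (Thus if $\widetilde{G}$ is a tree, $T_{\widetilde{G}}=[T_{\widetilde{G}}]=G$; if $\widetilde{G}$ is a cycle, $T_{\widetilde{G}}$ is a single cyclic vertex and $[T_{\widetilde{G}}]$ is empty, with matching number $0$.) *)

(* Defs.v *)
From mathcomp Require Import all_boot all_order all_algebra.

Set Implicit Arguments.
Unset Strict Implicit.
Unset Printing Implicit Defensive.

Import Order.TTheory GRing.Theory Num.Theory.
Local Open Scope ring_scope.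

(* [edge] is the adjacency of the underlying simple graph; [arc x y] says that
   the edge xy has been oriented from x to y. *)
Record mixed_graph (V : finType) := MixedGraph {
  edge : rel V;
  arc : rel V;
  edge_sym : symmetric edge;
  edge_irr : irreflexive edge;
  arc_edge : subrel arc edge;
  arc_asym : forall x y, arc x y -> ~~ arc y x
}.

Section SimpleGraph.

Variables (V : finType) (e : rel V).

Definition edge_set : {set {set V}} :=
  [set B | [exists x, exists y, e x y && (B == [set x; y])]].

Definition is_matching (M : {set {set V}}) : bool :=
  (M \subset edge_set) && trivIset M.

Definition matching_number : nat :=
  \max_(M : {set {set V}} | is_matching M) #|M|.

Definition components : nat := n_comp e predT.

Definition cyclomatic_number : int :=
  #|edge_set|%:Z - #|V|%:Z + components%:Z.

(* The sequence is a closed traversal of the cycle, the last vertex being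
   adjacent to the first; a cycle of length q thus has 2q traversals, and two
   traversals describe the same cycle iff they have the same [cycle_edges]. *)
Definition is_cycle (s : seq V) : bool :=
  [&& (2 < size s)%N, uniq s & cycle e s].

Definition cycle_edges (s : seq V) : {set {set V}} :=
  [set [set x; next s x] | x in s].

Definition cycles_disjoint : Prop :=
  forall s t : seq V, is_cycle s -> is_cycle t ->
    cycle_edges s != cycle_edges t -> [disjoint s & t].

Definition is_cycle_set (B : {set V}) : bool :=
  [exists s : #|B|.-tuple V, is_cycle s && (B == [set x in s])].

Definition on_cycle (x : V) : bool :=
  [exists B : {set V}, is_cycle_set B && (x \in B)].

(* Vertices of the graph obtained by contracting every cycle: [inl] are the
   cyclic vertices, [inr] the others.  This is meaningful when distinct cycles
   are vertex disjoint, in which case a cycle is determined by its vertices. *)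
Definition contraction_vertex : finType :=
  ({B : {set V} | is_cycle_set B} + {x : V | ~~ on_cycle x})%type.

Definition contraction_fiber (u : contraction_vertex) : {set V} :=
  match u with inl B => val B | inr x => [set val x] end.

Definition contraction_edge : rel contraction_vertex :=
  fun u v => (u != v) &&
    [exists x in contraction_fiber u, exists y in contraction_fiber v, e x y].

Definition noncyclic_vertex (u : contraction_vertex) : bool :=
  match u with inl _ => false | inr _ => true end.

Definition induced (P : pred V) : rel {x : V | P x} :=
  fun x y => e (val x) (val y).

End SimpleGraph.

Arguments contraction_edge {V} e u v.

Definition contraction_noncyclic (V : finType) (e : rel V) :
    rel {u : contraction_vertex e | noncyclic_vertex u} :=
  induced (contraction_edge e) (P := @noncyclic_vertex V e).

Arguments contraction_noncyclic {V} e x y : rename.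

Section MixedGraph.

Variables (V : finType) (G : mixed_graph V).

Definition signature (s : seq V) : nat :=
  let f := count (fun x => arc G x (next s x)) s in
  let b := count (fun x => arc G (next s x) x) s in
  `|f%:Z - b%:Z|%N.

Definition connected : Prop := components (edge G) = 1%N.

Variable C : numClosedFieldType.

Definition hermitian_entry (x y : V) : C :=
  if arc G x y then 'i else if arc G y x then - 'i else (edge G x y)%:R.

Definition hermitian_adjacency : 'M[C]_#|V| :=
  \matrix_(k, l) hermitian_entry (enum_val k) (enum_val l).

End MixedGraph.

Section Eigenvalues.

Variables (C : numClosedFieldType) (n : nat).

(* Listed with algebraic multiplicity. *)
Definition eigenvalues (A : 'M[C]_n) : seq C :=
  sval (closed_field_poly_normal (char_poly A)).

Lemma char_poly_eigenvalues (A : 'M[C]_n) :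
  char_poly A = \prod_(z <- eigenvalues A) ('X - z%:P).
Proof.
rewrite /eigenvalues; case: closed_field_poly_normal => r /=.
by rewrite (monicP (char_poly_monic A)) scale1r.
Qed.

End Eigenvalues.

Lemma hermitian_adjacency_herm (V : finType) (G : mixed_graph V)
    (C : numClosedFieldType) :
  (map_mx Num.conj (hermitian_adjacency G C))^T = hermitian_adjacency G C.
Proof.
apply/matrixP=> k l; rewrite !mxE /hermitian_entry.
case a1: (arc G _ _); case a2: (arc G _ _).
- by move: (arc_asym a1); rewrite a2.
- by rewrite conjCi.
- by rewrite rmorphN /= conjCi opprK.
- by rewrite edge_sym conjC_nat.
Qed.

Definition positive_inertia (V : finType) (G : mixed_graph V)
    (C : numClosedFieldType) : nat :=
  count (fun z : C => 0 < z) (eigenvalues (hermitian_adjacency G C)).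

(* Main.v *)
Require Import Defs.
From Stdlib Require Import FunctionalExtensionality.
From mathcomp Require Import all_boot all_order all_algebra spectral.
From mathcomp Require Import zify ring.

(** Write p, m and c for the positive inertia, the matching number and the
    cyclomatic number.  Deleting a vertex v lowers p by at most 1, and by
    exactly 1 if v has a pendant neighbour; it lowers c by at least 1 if v lies
    on a cycle, and by at least 2 if v lies on two cycles.  Hence p <= m + c by
    induction, and in the extremal case cycles are disjoint, the neighbour of a
    pendant vertex is noncyclic, and m is unchanged when a cyclic vertex is
    deleted.  A cycle which is a component is extremal iff it is odd of the
    right sign: a vector supported on the cycle and orthogonal to all its
    vertices but one has, up to a positive factor, the value
    (-1)^m Re(weight of the cycle).

    Both sides of the equivalence amount to [reducible]: the graph is exhausted
    by deleting noncyclic neighbours of pendant vertices and isolated good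
    cycles.  Otherwise, once no pendant vertex is left, some cycle is attached
    to the rest of the graph through a single edge to a vertex y; what remains
    without this cycle is reducible and has no pendant vertex but possibly y in
    the component of y, so y is missed by a maximum matching, which extends by
    the attaching edge: this contradicts extremality, and also (iii). *)

Set Implicit Arguments.
Unset Strict Implicit.
Unset Printing Implicit Defensive.

(** * Vertex and edge deletion, matchings *)

Section Deletion.

Variable V : finType.
Implicit Types (e : rel V) (S : {set V}).

Definition simple_graph e := symmetric e /\ irreflexive e.

(* Deleted vertices stay in the vertex type as isolated vertices: this changes
   neither the matching number, nor the cyclomatic number, nor the positive
   inertia. *)
Definition vdel e S : rel V := fun x y => [&& e x y, x \notin S & y \notin S].

Definition edel e x y : rel V :=
  fun a b => e a b && ([set a; b] != [set x; y]).

Lemma vdel_sub e S : subrel (vdel e S) e.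
Proof. by move=> x y /andP[]. Qed.

Lemma edel_sub e x y : subrel (edel e x y) e.
Proof. by move=> a b /andP[]. Qed.

Lemma simple_vdel e S : simple_graph e -> simple_graph (vdel e S).
Proof.
case=> es ei; split=> [x y|x]; last by rewrite /vdel ei.
by rewrite /vdel es [(x \notin S) && _]andbC.
Qed.

Lemma simple_edel e x y : simple_graph e -> simple_graph (edel e x y).
Proof.
by case=> es ei; split=> [a b|a]; [rewrite /edel es setUC | rewrite /edel ei].
Qed.

Lemma relext e e' : e =2 e' -> e = e'.
Proof.
by move=> ee; do 2![apply: functional_extensionality=> ?]; apply: ee.
Qed.

Lemma vdelU e S T : vdel (vdel e S) T = vdel e (S :|: T).
Proof.
by apply: relext => x y; rewrite /vdel !inE; case: (e x y); case: (x \in S);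
  case: (y \in S); case: (x \in T).
Qed.

Lemma vdelC e S T : vdel (vdel e S) T = vdel (vdel e T) S.
Proof. by rewrite !vdelU setUC. Qed.

End Deletion.

Section Matching.

Variable V : finType.
Implicit Types (e : rel V) (M : {set {set V}}) (S : {set V}).

Lemma edge_setP e (B : {set V}) :
  reflect (exists x y, e x y /\ B = [set x; y]) (B \in edge_set e).
Proof.
rewrite inE; apply: (iffP existsP) => [[x /existsP[y /andP[exy /eqP->]]]|].
  by exists x, y.
by case=> x [y [exy ->]]; exists x; apply/existsP; exists y; rewrite exy eqxx.
Qed.

Lemma edge_set_homo e e' : subrel e e' -> edge_set e \subset edge_set e'.
Proof.
move=> ee; apply/subsetP=> B /edge_setP[x [y [exy ->]]].
by apply/edge_setP; exists x, y; split=> //; apply: ee.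
Qed.

Lemma matching_leq e M : is_matching e M -> #|M| <= matching_number e.
Proof. by move=> mM; apply: (leq_bigmax_cond (F := fun M => #|M|)). Qed.

Lemma matching_max e : exists2 M, is_matching e M & #|M| = matching_number e.
Proof.
have m0 : is_matching e set0.
  by rewrite /is_matching sub0set; apply/trivIsetP => A B; rewrite inE.
rewrite /matching_number (bigmax_eq_arg set0) //.
by case: arg_maxnP => // M mM _; exists M.
Qed.

Lemma matchingP e M :
  reflect (M \subset edge_set e /\
      forall (A B : {set V}) x, A \in M -> B \in M -> x \in A -> x \in B -> A = B)
    (is_matching e M).
Proof.
apply: (iffP andP) => [[-> /trivIsetP tM]|[-> tM]]; split=> //.
  move=> A B x AM BM xA xB; apply/eqP; apply: contraTT xA => AB.
  by have := disjointFl (tM _ _ AM BM AB) xB => ->.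
apply/trivIsetP=> A B AM BM AB; rewrite disjoint_subset; apply/subsetP=> x xA.
by apply: contra AB => xB; apply/eqP/(tM A B x).
Qed.

Lemma matching_number_homo e e' :
  subrel e e' -> matching_number e <= matching_number e'.
Proof.
move=> ee; have [M /matchingP[Me tM] <-] := matching_max e.
apply/matching_leq/matchingP; split=> //.
exact: subset_trans Me (edge_set_homo ee).
Qed.

Lemma matching_number_vdel e S :
  matching_number (vdel e S) <= matching_number e.
Proof. exact/matching_number_homo/vdel_sub. Qed.

Lemma matching_number0 e : (forall x y, ~~ e x y) -> matching_number e = 0.
Proof.
move=> e0; have [M /matchingP[Me _] <-] := matching_max e.
apply: eq_card0 => B; apply: contraTF isT => /(subsetP Me) /edge_setP.
by case=> x [y [exy _]]; have := e0 x y; rewrite exy.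
Qed.

Lemma matching_number_add_edge e a b :
  e a b -> (matching_number (vdel e [set a; b])).+1 <= matching_number e.
Proof.
move=> eab; have [M /matchingP[Me tM] <-] := matching_max (vdel e [set a; b]).
have abM B x : B \in M -> x \in B -> x \notin [set a; b].
  by case/(subsetP Me)/edge_setP=> y [z [/and3P[_ ? ?] ->]] /set2P[]->.
have nM : [set a; b] \notin M.
  by apply/negP=> /abM /(_ (set21 a b)); rewrite set21.
rewrite -add1n -[1](cards1 [set a; b]) -cardsUI setIC.
rewrite (_ : _ :&: _ = set0) ?cards0 ?addn0; last first.
  by apply/setP=> B; rewrite !inE andbC; apply: contraNF nM => /andP[/eqP<-].
apply/matching_leq/matchingP; split.
  rewrite subUset sub1set; apply/andP; split.
    by apply/edge_setP; exists a, b.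
  exact: subset_trans Me (edge_set_homo (@vdel_sub _ _ _)).
move=> A B x /setU1P[->|AM] /setU1P[->|BM] // xA xB; last exact: (tM A B x).
  by have := abM _ _ BM xB; rewrite xA.
by have := abM _ _ AM xA; rewrite xB.
Qed.

Lemma card_edge e (B : {set V}) :
  irreflexive e -> B \in edge_set e -> #|B| = 2.
Proof.
move=> ei /edge_setP[x [y [exy ->]]]; rewrite cards2.
by case: eqVneq exy => // ->; rewrite ei.
Qed.

Lemma matching_split e S M : is_matching e M ->
  exists2 N : {set {set V}}, N \subset M /\
    (forall B : {set V}, B \in N -> exists2 x, x \in B & x \in S) &
    #|M| <= matching_number (vdel e S) + #|N|.
Proof.
move=> /matchingP[Me tM].
exists [set B in M | B :&: S != set0].
  split=> [|B]; first by apply/subsetP=> B; rewrite inE => /andP[].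
  by rewrite inE => /andP[_ /set0Pn[x /setIP[]]]; exists x.
rewrite -(cardsID [set B | B :&: S != set0] M) addnC leq_add //.
  apply/matching_leq/matchingP; split=> [|A B x]; last first.
    by move=> /setDP[AM _] /setDP[BM _]; apply: tM.
  apply/subsetP=> B /setDP[/(subsetP Me)/edge_setP[x [y [exy ->]]]].
  rewrite inE negbK => /eqP/setP BS; apply/edge_setP; exists x, y; split=> //.
  rewrite /vdel exy; have := BS x; have := BS y; rewrite !inE !eqxx orbT /=.
  by move=> -> ->.
by apply: subset_leq_card; apply/subsetP=> B; rewrite !inE.
Qed.

Lemma matching_number_vdel_geq e S :
  matching_number e <= matching_number (vdel e S) + #|S|.
Proof.
have [M mM <-] := matching_max e.
have [N [NM NS] /leq_trans->//] := matching_split S mM.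
rewrite leq_add2l; have /matchingP[_ tM] := mM.
pose f B := odflt set0 [pick C in N | B \in C].
apply: leq_trans (leq_imset_card f S); apply: subset_leq_card.
apply/subsetP=> B BN; have [x xB xS] := NS _ BN.
apply/imsetP; exists x => //; rewrite /f; case: pickP => [C /andP[CN xC]|].
  by apply: (tM _ _ x) => //; apply: subsetP NM _ _.
by move/(_ B); rewrite BN xB.
Qed.

Lemma matching_number_cover e S :
  (forall x y, e x y -> (x \in S) || (y \in S)) -> matching_number e <= #|S|.
Proof.
move=> cS; apply: leq_trans (matching_number_vdel_geq e S) _.
rewrite matching_number0 // => x y; apply/negP => /and3P[/cS].
by case/orP=> ->.
Qed.

Lemma matching_number_closed e S : irreflexive e ->
  (forall x y, e x y -> (x \in S) = (y \in S)) ->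
  matching_number e <= matching_number (vdel e S) + #|S|./2.
Proof.
move=> ei cS; have [M mM <-] := matching_max e.
have [N [NM NS] /leq_trans->//] := matching_split S mM.
rewrite leq_add2l; have [Me tM] := andP mM.
have tN : trivIset N by move/trivIsetP: tM => tM; apply/trivIsetP => A B AN BN;
  apply: tM; apply: subsetP NM _ _.
have Ne : {in N, forall B : {set V}, #|B| = 2}.
  by move=> B BN; apply: card_edge ei _; apply/(subsetP Me)/(subsetP NM).
have /subset_leq_card : cover N \subset S.
  apply/subsetP=> x /bigcupP[B BN xB]; have [y yB yS] := NS _ BN.
  have /(subsetP NM)/(subsetP Me)/edge_setP[a [b [eab BE]]] := BN.
  move: xB yB; rewrite BE => /set2P[]->/set2P[] yE; subst y => //.
    by rewrite (cS _ _ eab).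
  by rewrite -(cS _ _ eab).
rewrite -(eqP tN) (eq_bigr (fun=> 2)) ?sum_nat_const //.
by move: #|N| #|S| => a b; lia.
Qed.

Lemma matching_number_path e p : uniq p -> sorted e p ->
  matching_number (vdel e [set x in p]) + (size p)./2 <= matching_number e.
Proof.
have [n] := ubnP (size p); elim: n e p => // n IH e [|a [|b p]] /=.
- by rewrite addn0 matching_number_vdel.
- by rewrite addn0 matching_number_vdel.
rewrite !ltnS !inE !negb_or => sp /and3P[/andP[ab ap] bp up] /andP[eab ebp].
apply: leq_trans (matching_number_add_edge eab).
rewrite addnS ltnS (_ : [set _ in _] = [set a; b] :|: [set x in p]); last first.
  by apply/setP=> x; rewrite !inE orbA.
rewrite -vdelU; apply: IH => //; first exact: ltnW.
have sbp := path_sorted ebp; apply: (sub_in_sorted (P := [in p])) sbp => [x y xp yp exy|].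
  rewrite /vdel exy !inE !negb_or; apply/and3P; split=> //.
    by apply/andP; split; apply: contraTneq xp => ->.
  by apply/andP; split; apply: contraTneq yp => ->.
exact: allss.
Qed.

End Matching.

Section MatchingTransfer.

Variables (V W : finType) (e : rel V) (e' : rel W).

Lemma matching_number_imset (f : V -> W) (A : {set V}) :
    (forall x y, e x y -> [/\ x \in A, y \in A & e' (f x) (f y)]) ->
    {in A &, injective f} ->
  matching_number e <= matching_number e'.
Proof.
move=> fe fi; have [M /matchingP[Me tM] <-] := matching_max e.
have MA B : B \in M -> B \subset A.
  case/(subsetP Me)/edge_setP=> x [y [/fe[xA yA _] ->]].
  by rewrite subUset !sub1set xA.
have iM : {in M &, injective (fun B : {set V} => f @: B)}.
  move=> B B' /[dup] BM /MA/subsetP BA /[dup] B'M /MA/subsetP B'A /setP BB'.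
  apply/setP=> x; apply/idP/idP => xB; have := imset_f f xB;
    [rewrite BB'|rewrite -BB'] => /imsetP[y yB /fi->] //; auto.
rewrite -(card_in_imset iM); apply/matching_leq/matchingP; split.
  apply/subsetP=> _ /imsetP[B /(subsetP Me)/edge_setP[x [y [/fe[_ _ exy] ->]]] ->].
  by apply/edge_setP; exists (f x), (f y); rewrite imsetU !imset_set1.
move=> _ _ z /imsetP[B BM ->] /imsetP[B' B'M ->] /imsetP[x xB ->].
move=> /imsetP[y yB' /fi xy]; rewrite (tM B B' x) //.
have -> : x = y by apply: xy; [apply: subsetP xB | apply: subsetP yB']; apply: MA.
by [].
Qed.

Lemma matching_number_preimset (g : W -> V) : injective g ->
    (forall x y, e x y -> exists x' y', [/\ g x' = x, g y' = y & e' x' y']) ->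
  matching_number e <= matching_number e'.
Proof.
move=> gi ge; have [M /matchingP[Me tM] <-] := matching_max e.
have gM B : B \in M -> g @: (g @^-1: B) = B.
  case/(subsetP Me)/edge_setP=> x [y [/ge[x' [y' [<- <- _]]] ->]].
  apply/setP=> z; apply/imsetP/set2P => [[w]|[]->].
  - by rewrite !inE => /orP[] /eqP/gi -> ->; [left|right].
  - by exists x'; rewrite ?inE ?eqxx.
  - by exists y'; rewrite ?inE ?eqxx ?orbT.
have iM : {in M &, injective (fun B : {set V} => g @^-1: B)}.
  by move=> B B' BM B'M BB'; rewrite -(gM _ BM) -(gM _ B'M) BB'.
rewrite -(card_in_imset iM); apply/matching_leq/matchingP; split.
  apply/subsetP=> _ /imsetP[B BM ->]; apply/edge_setP.
  have /(subsetP Me)/edge_setP[_ [_ [/ge[x [y [<- <- e'xy]]] ->]]] := BM.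
  by exists x, y; split=> //; apply/setP=> z; rewrite !inE !(inj_eq gi).
move=> _ _ z /imsetP[B BM ->] /imsetP[B' B'M ->]; rewrite !inE => zB zB'.
by rewrite (tM _ _ _ BM B'M zB zB').
Qed.

End MatchingTransfer.

(** * Cycles and the cyclomatic number *)

Lemma set2_eq (T : finType) (a b x y : T) :
  [set a; b] = [set x; y] -> a = x /\ b = y \/ a = y /\ b = x.
Proof.
move/setP=> E; have /set2P[aE|aE] : a \in [set x; y] by rewrite -E set21.
  have /set2P[bE|bE] : b \in [set x; y] by rewrite -E set22.
    left; have : y \in [set a; b] by rewrite E set22.
    by rewrite aE bE setUid => /set1P.
  by left.
have /set2P[bE|bE] : b \in [set x; y] by rewrite -E set22.
  by right.
right; have : x \in [set a; b] by rewrite E set21.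
by rewrite aE bE setUid => /set1P.
Qed.

Section Cycles.

Variable V : finType.
Implicit Types (e : rel V) (s t p : seq V) (S : {set V}).

Lemma cycle_edgesP s (B : {set V}) :
  reflect (exists2 x, x \in s & B = [set x; next s x]) (B \in cycle_edges s).
Proof. exact: imsetP. Qed.

Lemma is_cycle_next e s x : is_cycle e s -> x \in s -> e x (next s x).
Proof. by case/and3P=> _ _ /next_cycle; apply. Qed.

Lemma is_cycle_homo e e' s :
  (forall x, x \in s -> e x (next s x) -> e' x (next s x)) ->
  is_cycle e s -> is_cycle e' s.
Proof.
move=> ee cs; have /and3P[s2 us _] := cs; apply/and3P; split=> //.
by apply: cycle_from_next => // x xs; apply/ee/is_cycle_next.
Qed.

Lemma is_cycle_vdel e S s :
  is_cycle (vdel e S) s <-> is_cycle e s /\ [disjoint s & S].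
Proof.
split=> [cs|[cs dS]]; first split.
- by apply: is_cycle_homo cs => x _ /andP[].
- rewrite disjoint_subset; apply/subsetP=> x xs.
  by have /and3P[] := is_cycle_next cs xs.
apply: is_cycle_homo cs => x xs exy; rewrite /vdel exy.
by rewrite !(disjointFr dS) // mem_next.
Qed.

Lemma is_cycle_rot e n s : is_cycle e (rot n s) = is_cycle e s.
Proof. by rewrite /is_cycle size_rot rot_uniq rot_cycle. Qed.

Lemma cycle_edges_mem s t : cycle_edges s = cycle_edges t -> s =i t.
Proof.
suff sub s' t' : cycle_edges s' = cycle_edges t' -> {subset s' <= t'}.
  by move=> st x; apply/idP/idP; apply: sub.
move=> /setP st x xs; have /cycle_edgesP[y yt] : [set x; next s' x] \in cycle_edges t'.
  by rewrite -st; apply/cycle_edgesP; exists x.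
move/setP=> /(_ x); rewrite set21 => /esym/set2P[]-> //.
by rewrite mem_next.
Qed.

Lemma connect_cycle_edge e s x : symmetric e -> is_cycle e s -> x \in s ->
  connect (edel e x (next s x)) (next s x) x.
Proof.
move=> es cs xs; have /and3P[_ us _] := cs; have [i p sE] := rot_to xs.
rewrite -(next_rot i us) sE; move: cs; rewrite -(is_cycle_rot e i) sE.
case: p {sE} => [|y [|z p]] // /and3P[_ /=].
rewrite eqxx !inE !negb_or => /and3P[/and3P[xy xz xp] /andP[yz yp] _].
case/and3P=> exy eyz zp; apply/connectP; exists (z :: rcons p x); last first.
  by rewrite /= last_rcons.
have yP a b : e a b -> a != y -> b != y -> edel e x y a b.
  move=> eab ay yb; rewrite /edel eab; apply: contraNneq ay => /setP/(_ y).
  by rewrite set22 => /set2P[->//|yE]; rewrite yE eqxx in yb.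
rewrite /= {1}/edel eyz; apply/andP; split.
  apply: contraNneq xz => /setP/(_ x); rewrite set21 => /set2P[xE|->] //.
  by rewrite xE eqxx in xy.
apply: (sub_in_path (P := [pred a | a != y])) zp => [a b ay yb|]; first by move/yP; apply.
rewrite /= eq_sym yz all_rcons /= xy; apply/allP => a ap /=.
by apply: contraNneq yp => <-.
Qed.

Lemma cycle_of_connect e x y : irreflexive e -> e x y ->
  connect (edel e x y) y x -> exists p, is_cycle e [:: x, y & p].
Proof.
move=> ei exy /connectP[q]; case/shortenP=> q' pq uq _.
case/lastP: q' pq uq => [|q' z].
  by move=> _ _ /= xE; move: exy; rewrite xE ei.
rewrite last_rcons => pq uq zE; subst z; exists q'; apply/and3P; split.
- case: q' pq {uq} => //=; rewrite andbT /edel => /andP[_].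
  by rewrite setUC eqxx.
- by move: uq; rewrite /= mem_rcons rcons_uniq !inE !negb_or eq_sym -!andbA; 
    case/and4P=> -> -> -> ->.
- by rewrite /= exy /=; apply: sub_path pq => a b /andP[].
Qed.

Lemma is_cycle_setP e (B : {set V}) :
  reflect (exists2 s, is_cycle e s & B = [set x in s]) (is_cycle_set e B).
Proof.
apply: (iffP existsP) => [[s /andP[cs /eqP->]]|[s cs ->]]; first by exists s.
have ss : size s == #|[set x in s]|.
  by rewrite cardsE; case/and3P: cs => _ /card_uniqP->.
by exists (Tuple ss); rewrite cs eqxx.
Qed.

Lemma on_cycleP e x :
  reflect (exists2 s, is_cycle e s & x \in s) (on_cycle e x).
Proof.
apply: (iffP existsP) => [[B /andP[/is_cycle_setP[s cs ->]]]|[s cs xs]].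
  by rewrite inE; exists s.
exists [set x in s]; rewrite inE xs andbT.
by apply/is_cycle_setP; exists s.
Qed.

Definition on_same_cycle e x y :=
  [exists B : {set V}, [&& is_cycle_set e B, x \in B & y \in B]].

Lemma on_same_cycleP e x y :
  reflect (exists s, [/\ is_cycle e s, x \in s & y \in s])
    (on_same_cycle e x y).
Proof.
apply: (iffP existsP) => [[B /and3P[/is_cycle_setP[s cs ->]]]|[s [cs xs ys]]].
  by rewrite !inE; exists s.
exists [set x in s]; rewrite !inE xs ys !andbT.
by apply/is_cycle_setP; exists s.
Qed.

Lemma on_cycle_edge e x : simple_graph e -> ~~ on_cycle e x ->
  forall y, e x y -> ~~ connect (edel e x y) x y.
Proof.
move=> [es ei] xc y exy; apply: contra xc.
have [es' _] := simple_edel x y (conj es ei).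
rewrite (sym_connect_sym es') => /(cycle_of_connect ei exy)[p cp].
by apply/on_cycleP; exists [:: x, y & p]; rewrite ?inE ?eqxx.
Qed.

Lemma on_cycle_sub e e' x : subrel e e' -> on_cycle e x -> on_cycle e' x.
Proof.
move=> ee /on_cycleP[s cs xs]; apply/on_cycleP; exists s => //.
by apply: is_cycle_homo cs => a _; apply: ee.
Qed.

End Cycles.

Section Cyclomatic.

Variable V : finType.
Implicit Types (e : rel V) (s t p : seq V) (S : {set V}).

Lemma components_edel e x y : simple_graph e -> e x y ->
  components (edel e x y) = components e + ~~ connect (edel e x y) x y.
Proof.
move=> se exy; set e' := edel e x y.
have cs : connect_sym e by apply: sym_connect_sym; case: se.
have cs' : connect_sym e'.
  by apply: sym_connect_sym; case: (simple_edel x y se).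
have ee : subrel (connect e') (connect e).
  by apply: connect_sub => a b /edel_sub; apply: connect1.
have E a b : e a b -> [\/ e' a b, a = x /\ b = y | a = y /\ b = x].
  move=> eab; have [ab|nab] := eqVneq [set a; b] [set x; y]; last first.
    by apply: Or31; rewrite /e' /edel eab.
  by have [|] := set2_eq ab; [apply: Or32 | apply: Or33].
have [cxy|ncxy] := boolP (connect e' x y).
  rewrite addn0; apply: eq_n_comp => a b; apply/idP/idP; first exact: ee.
  apply: connect_sub => {}a {}b /E[/connect1//|[-> ->] //|[-> ->]].
  by rewrite cs'.
pose a : pred V := closure e' (pred2 x y).
rewrite /components (n_compC a e') (n_compC a e) addn1 -addSn; congr (_ + _).
  have -> : n_comp e a = 1.
    rewrite -(n_comp_connect cs x); apply: eq_n_comp_r => z.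
    apply/idP/idP.
      case/pred0Pn=> t /andP[/= /ee czt /pred2P[]tE]; subst t.
        by rewrite inE cs.
      by rewrite inE; apply: connect_trans (connect1 exy) _; rewrite cs.
    rewrite !inE => /connectP[p ep ->].
    have : x \in a by apply: mem_closure; rewrite !inE eqxx.
    elim: p (x) ep => //= b p IH c /andP[/E ecb pb] ac; apply: IH => //.
    have [d|[_ ->]|[_ ->]] := ecb.
    - by rewrite -(closure_closed cs' _ d).
    - by apply: mem_closure; rewrite !inE eqxx orbT.
    - by apply: mem_closure; rewrite !inE eqxx.
  by rewrite n_comp_closure2 // ncxy.
apply: eq_card => z; rewrite !inE; case az: (z \in a); rewrite ?andbF //= !andbT.
rewrite /roots /root; congr (odflt _ _ == _); apply: eq_pick => t.
apply/idP/idP; first exact: ee.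
move=> /connectP[p pp ->]; elim: p z az pp => //= b p IH c ac /andP[ecb pb].
have e'cb : e' c b.
  case: (E _ _ ecb) ac => // -[-> _];
  by rewrite (mem_closure) // !inE eqxx ?orbT.
apply: connect_trans (connect1 e'cb) _; apply: IH => //.
by rewrite -(closure_closed cs' _ e'cb).
Qed.

Local Open Scope ring_scope.
Import Order.TTheory GRing.Theory Num.Theory.

Lemma cyclomatic_edel e x y : simple_graph e -> e x y ->
  cyclomatic_number (edel e x y)
    = cyclomatic_number e - 1 + (~~ connect (edel e x y) x y)%:Z.
Proof.
move=> se exy; rewrite /cyclomatic_number components_edel //.
have -> : edge_set (edel e x y) = edge_set e :\ [set x; y].
  apply/setP=> B; rewrite in_setD1; apply/edge_setP/andP.
    move=> [a [b [/andP[eab nab] ->]]]; split=> //.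
    by apply/edge_setP; exists a, b.
  by case=> nB /edge_setP[a [b [eab BE]]]; exists a, b; rewrite /edel eab -BE nB.
have : [set x; y] \in edge_set e by apply/edge_setP; exists x, y.
rewrite (cardsD1 [set x; y] (edge_set e)) => -> /=.
rewrite !PoszD; move: (nat_of_bool _) (#|_ :\ _|) (#|V|) (components e) => k p q r; lia.
Qed.

Lemma vdel1_edel e x y : vdel (edel e x y) [set x] = vdel e [set x].
Proof.
apply: relext => a b; rewrite /vdel /edel !inE; case: (e a b) => //=.
case: (eqVneq [set a; b]) => //= /setP/(_ x); rewrite !inE eqxx.
by rewrite ![x == _]eq_sym; case: eqP; case: eqP.
Qed.

Lemma vdel_isolated e x : symmetric e ->
  (forall y, ~~ e x y) -> vdel e [set x] = e.
Proof.
move=> es nx; apply: relext => a b; rewrite /vdel !inE.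
case eab: (e a b) => //=; apply/andP; split; apply: contraTneq eab => ->.
  exact: nx.
by rewrite es.
Qed.

Lemma cyclomatic_vdel1 e x : simple_graph e ->
  (cyclomatic_number (vdel e [set x]) <= cyclomatic_number e)
  && (~~ on_cycle e x ==>
    (cyclomatic_number (vdel e [set x]) == cyclomatic_number e)).
Proof.
have [n] := ubnP #|e x|; elim: n e => // n IH e en se.
have [y exy|nx] := pickP (e x); last first.
  rewrite vdel_isolated ?lexx ?eqxx ?implybT //; first by case: se.
  by move=> y; rewrite nx.
have /IH : (#|edel e x y x| < n)%N.
  rewrite -ltnS; apply: leq_trans en; rewrite ltnS; apply: proper_card.
  apply/properP; split; first by apply/subsetP=> b /andP[].
  by exists y => //; rewrite unfold_in /edel eqxx andbF.
move=> /(_ (simple_edel x y se)); rewrite vdel1_edel => /andP[le /implyP eqv].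
have ce := cyclomatic_edel se exy; apply/andP; split.
  by move: le; rewrite ce; case: connect => /=; lia.
apply/implyP=> ncx; have /eqP-> : cyclomatic_number (vdel e [set x])
    == cyclomatic_number (edel e x y).
  by apply/eqv/(contra _ ncx)/on_cycle_sub/edel_sub.
by rewrite ce (on_cycle_edge se ncx exy) /= subrK.
Qed.

Lemma vdel0 e : vdel e set0 = e.
Proof. by apply: relext => x y; rewrite /vdel !inE !andbT. Qed.

Lemma cyclomatic_vdel e S : simple_graph e ->
  cyclomatic_number (vdel e S) <= cyclomatic_number e.
Proof.
have [n] := ubnP #|S|; elim: n S => // n IH S nS se.
have [->|[x xS]] := set_0Vmem S; first by rewrite vdel0.
rewrite -(setD1K xS) setUC -vdelU.
have /andP[/le_trans-> //] := cyclomatic_vdel1 x (simple_vdel (S :\ x) se).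
by apply: IH => //; rewrite (cardsD1 x) xS in nS.
Qed.

Lemma cyclomatic_vdel_noncyclic e S : simple_graph e ->
  (forall x, x \in S -> ~~ on_cycle e x) ->
  cyclomatic_number (vdel e S) = cyclomatic_number e.
Proof.
have [n] := ubnP #|S|; elim: n S => // n IH S nS se ncS.
have [->|[x xS]] := set_0Vmem S; first by rewrite vdel0.
rewrite -(setD1K xS) setUC -vdelU.
have /andP[_ /implyP/(_ _)/eqP->] := cyclomatic_vdel1 x (simple_vdel (S :\ x) se).
  apply: IH => //; first by rewrite (cardsD1 x) xS in nS.
  by move=> y /setD1P[_ /ncS].
by apply: contra (ncS _ xS); apply/on_cycle_sub/vdel_sub.
Qed.

Lemma cyclomatic_vdel_cyclic e s x : simple_graph e -> is_cycle e s ->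
  x \in s -> cyclomatic_number (vdel e [set x]) <= cyclomatic_number e - 1.
Proof.
move=> se cs xs; have exy := is_cycle_next cs xs.
rewrite -(vdel1_edel _ _ (next s x)).
apply: le_trans (cyclomatic_vdel _ (simple_edel _ _ se)) _.
rewrite cyclomatic_edel // (sym_connect_sym (proj1 (simple_edel _ _ se))).
by rewrite connect_cycle_edge ?addr0 //; case: se.
Qed.

Lemma cyclomatic_vdel_two_cycles e s t x : simple_graph e ->
    is_cycle e s -> is_cycle e t -> x \in s -> x \in t ->
    [set x; next t x] \notin cycle_edges s ->
  cyclomatic_number (vdel e [set x]) <= cyclomatic_number e - 2.
Proof.
move=> se cs ct xs xt nts; have exy := is_cycle_next ct xt.
rewrite -(vdel1_edel _ _ (next t x)).
apply: le_trans (@cyclomatic_vdel_cyclic _ s _ (simple_edel _ _ se) _ xs) _.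
  apply: is_cycle_homo cs => a sa eab; rewrite /edel eab.
  by apply: contraNneq nts => <-; apply/cycle_edgesP; exists a.
rewrite cyclomatic_edel // (sym_connect_sym (proj1 (simple_edel _ _ se))).
by rewrite connect_cycle_edge ?addr0 -?addrA //; case: se.
Qed.

Lemma cycles_share_vertex e s t z : is_cycle e s -> is_cycle e t ->
    cycle_edges s != cycle_edges t -> z \in s -> z \in t ->
  exists x, [/\ x \in s, x \in t &
    ([set x; next t x] \notin cycle_edges s)
    || ([set x; next s x] \notin cycle_edges t)].
Proof.
move=> cs ct nst zs zt.
have K s' t' : is_cycle e s' -> is_cycle e t' -> z \in s' -> z \in t' ->
    {in s', forall x, x \in t' -> [set x; next t' x] \in cycle_edges s'} ->
  cycle_edges t' \subset cycle_edges s'.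
  move=> cs' ct' zs' zt' H.
  have ts : {subset t' <= s'}.
    have /and3P[_ ut _] := ct'.
    move=> w wt; have : fconnect (next t') z w.
      by rewrite (fconnect_cycle (cycle_next ut) zt').
    case/connectP=> p; elim: p (z) zs' zt' => [|b p IH] a as' at' /=.
      by move=> _ ->.
    case/andP=> /eqP <-; apply: IH; rewrite ?mem_next //.
    have /cycle_edgesP[c cs1 /setP/(_ (next t' a))] := H _ as' at'.
    by rewrite set22 => /esym/set2P[]->; rewrite ?mem_next.
  by apply/subsetP=> B /cycle_edgesP[x xt ->]; apply: H; rewrite ?ts.
have [/hasP[x xs /andP[xt H]]|] := boolP (has (fun x => (x \in t) &&
   (([set x; next t x] \notin cycle_edges s)
    || ([set x; next s x] \notin cycle_edges t))) s).
  by exists x.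
move/hasPn=> H; case/negP: nst; rewrite eqEsubset.
apply/andP; split; apply: K => //.
  by move=> x xt xs; have := H _ xs; rewrite xt negb_or !negbK => /andP[].
by move=> x xs xt; have := H _ xs; rewrite xt negb_or !negbK => /andP[].
Qed.

Definition lone_cycle e s :=
  is_cycle e s /\ forall t x, is_cycle e t -> x \in s -> x \in t ->
    cycle_edges t = cycle_edges s.

Definition closed_in e s := forall a b, a \in s -> e a b -> b \in s.

Lemma lone_cycle_disjoint e s :
  cycles_disjoint e -> is_cycle e s -> lone_cycle e s.
Proof.
move=> de cs; split=> // t x ct xs xt; apply/eqP; apply/negPn/negP=> nts.
by have := disjointFl (de _ _ ct cs nts) xs; rewrite xt.
Qed.

Lemma cyclomatic_closed_cycle e s : simple_graph e -> lone_cycle e s ->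
    closed_in e s ->
  cyclomatic_number e <= cyclomatic_number (vdel e [set x in s]) + 1.
Proof.
move=> se [cs ls] cls; have /and3P[s2 _ _] := cs.
have [x xs] : exists x, x \in s.
  by case: (s) s2 => // x ? _; exists x; rewrite mem_head.
set e' := edel e x (next s x); have se' : simple_graph e' by apply: simple_edel.
have exy := is_cycle_next cs xs.
have -> : vdel e [set x in s] = vdel e' [set x in s].
  apply: relext => a b; rewrite /vdel /e' /edel !inE; case: (e a b) => //=.
  case: (eqVneq [set a; b]) => //= /setP/(_ x); rewrite !inE eqxx.
  by case/orP=> /eqP<-; rewrite xs ?andbF.
rewrite (@cyclomatic_vdel_noncyclic e') //.
  by rewrite cyclomatic_edel //; case: connect; lia.
move=> z; rewrite inE => zs; apply/negP=> /on_cycleP[t ct zt].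
have ct' : is_cycle e t by apply: is_cycle_homo ct => a _ /edel_sub.
have /setP/(_ [set x; next s x]) := ls _ _ ct' zs zt.
have -> : [set x; next s x] \in cycle_edges s.
  by apply/cycle_edgesP; exists x.
case/cycle_edgesP=> a at' aE; have := is_cycle_next ct at'.
by rewrite /e' /edel aE eqxx andbF.
Qed.

End Cyclomatic.

(** * Pendant vertices and leaf cycles *)

Section Leaves.

Variable V : finType.
Implicit Types (e : rel V) (s t p : seq V) (S : {set V}).

Definition pendant e u v := e u v /\ forall z, e u z -> z = v.

Lemma not_pendant e u v : ~ pendant e u v -> e u v ->
  exists2 z, e u z & z != v.
Proof.
move=> np euv; have [z /andP[euz zv]|H] := pickP [pred z | e u z && (z != v)].
  by exists z.
case: np; split=> // z euz; apply/eqP; apply/negPn/negP => zv.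
by have := H z; rewrite /= euz zv.
Qed.

Lemma pendant_noncyclic e u v : simple_graph e -> pendant e u v ->
  ~~ on_cycle e u.
Proof.
move=> se [euv uv]; apply/negP=> /on_cycleP[s cs us].
have en := is_cycle_next cs us; have nv := uv _ en.
have := connect_cycle_edge (proj1 se) cs us.
rewrite nv (sym_connect_sym (proj1 (simple_edel _ _ se))).
case/connectP=> -[_ /= vu|c q /= /andP[/andP[euc]]].
  by move: euv; rewrite vu (proj2 se).
by rewrite (uv _ euc) eqxx.
Qed.

Lemma pendant_vdel e u v : symmetric e -> pendant e u v ->
  vdel e [set u; v] = vdel e [set v].
Proof.
move=> es [_ uv]; apply: relext => a b; rewrite /vdel !inE.
case eab: (e a b) => //=; apply/idP/idP.
  by rewrite !negb_or => /andP[/andP[_ ->] /andP[_ ->]].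
case/andP=> av bv; rewrite (negbTE av) (negbTE bv) !orbF; apply/andP; split.
  by apply: contraNneq bv => au; apply/eqP/uv; rewrite -au.
by apply: contraNneq av => bu; apply/eqP/uv; rewrite -bu es.
Qed.

Lemma matching_number_pendant e u v : symmetric e -> pendant e u v ->
  (matching_number (vdel e [set v])).+1 <= matching_number e.
Proof.
move=> es pe; rewrite -(pendant_vdel es pe).
by apply: matching_number_add_edge; case: pe.
Qed.

Lemma cycle_exists e a b : simple_graph e -> e a b ->
  (forall u v, ~ pendant e u v) -> exists s, is_cycle e s.
Proof.
move=> [es ei] eab np.
suff [[x [y [p [_ up]]]]|//] : (exists x y p, [/\ path e x (y :: p),
    uniq [:: x, y & p] & size p = #|V|]) \/ exists s, is_cycle e s.
  move=> sp; have := max_card (mem [:: x, y & p]).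
  by rewrite (card_uniqP up) /= sp ltnNge leqnSn.
elim: #|V| => [|n [[x [y [p [pp up sp]]]]|]]; last by right.
  left; exists a, b, [::]; split=> //=; first by rewrite eab.
  by rewrite !inE andbT; apply: contraTneq eab => ->; rewrite ei.
have /andP[exy ep] : e x y && path e y p by [].
have [z exz zy] := not_pendant (np x y) exy.
have [zp|zp] := boolP (z \in p).
  right; case/splitPr: zp pp up {sp ep} => p1 p2 /= /andP[_].
  rewrite cat_path /= => /and3P[ep1 el _]; rewrite !inE !mem_cat !inE !negb_or.
  rewrite cat_uniq /= !negb_or -!andbA.
  case/and5P=> xy xp1 xz _ /and5P[yp1 yz _ up1 /andP[zp1 _]].
  exists [:: x, y & rcons p1 z]; apply/and3P; split.
  - by rewrite /= size_rcons.
  - rewrite /= !inE !mem_rcons !inE rcons_uniq !negb_or xy xz xp1 yz yp1 up1.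
    by rewrite zp1.
  - by rewrite /= exy !rcons_path ep1 el last_rcons es.
left; exists z, x, (y :: p); split; last by rewrite /= sp.
  by rewrite /= es exz exy ep.
rewrite cons_uniq up andbT !inE !negb_or zp zy !andbT.
by apply: contraTneq exz => ->; rewrite ei.
Qed.

Lemma connect_reached e e' x y :
    (forall a b, e a b -> connect e x a -> connect e x b -> e' a b) ->
  connect e x y -> connect e' x y.
Proof.
move=> ee /connectP[p pp ->]; elim/last_ind: p pp => //= p z IH.
rewrite rcons_path last_rcons => /andP[pp ez].
have xz : connect e x (last x p) by apply/connectP; exists p.
apply: connect_trans (IH pp) (connect1 _); apply: ee => //.
exact: connect_trans xz (connect1 ez).
Qed.

Lemma chord_connect e s x y : symmetric e -> is_cycle e s -> x \in s ->
  y \in s -> e x y -> connect (edel e x y) y x.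
Proof.
move=> es cs xs ys exy.
have [/cycle_edgesP[c cs' /set2_eq[[-> ->]|[-> ->]]]|nxy] :=
    boolP ([set x; y] \in cycle_edges s).
- exact: connect_cycle_edge.
- rewrite /edel setUC -/(edel e c (next s c)).
  rewrite (sym_connect_sym (e := edel _ _ _)) ?connect_cycle_edge //.
  by move=> a b; rewrite /edel es setUC.
suff /and3P[_ _ /connect_cycle] : is_cycle (edel e x y) s by apply.
apply: is_cycle_homo cs => a sa eab; rewrite /edel eab.
by apply: contraNneq nxy => <-; apply/cycle_edgesP; exists a.
Qed.

Lemma lone_cycle_mem e s a b : simple_graph e -> lone_cycle e s -> a \in s ->
  e a b -> connect (edel e a b) b a ->
  b \in s /\ (b = next s a \/ a = next s b).
Proof.
move=> [es ei] [cs ls] sa eab /(cycle_of_connect ei eab)[p cp].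
have E := ls _ a cp sa (mem_head _ _).
have bs : b \in s by rewrite -(cycle_edges_mem E) !inE eqxx orbT.
split=> //; have : [set a; b] \in cycle_edges s.
  by rewrite -E; apply/cycle_edgesP; exists a; rewrite ?mem_head //= eqxx.
by case/cycle_edgesP=> c _ /set2_eq[[-> ->]|[-> ->]]; [left|right].
Qed.

Lemma lone_cycle_chord e s a b : simple_graph e -> lone_cycle e s -> a \in s ->
  b \in s -> e a b -> b = next s a \/ a = next s b.
Proof.
move=> se ls sa sb eab; have := chord_connect (proj1 se) (proj1 ls) sa sb eab.
by case/(lone_cycle_mem se ls sa eab).
Qed.

(* [leaf_cycle e x p]: in the contracted graph, the cycle [x :: p] is an
   isolated vertex or a leaf attached to [y]. *)
Definition leaf_cycle e x p :=
  lone_cycle e (x :: p) /\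
  (closed_in e (x :: p) \/ exists y, [/\ e x y, y \notin x :: p &
    forall a b, a \in x :: p -> b \notin x :: p -> e a b -> a = x /\ b = y]).

(* A bridge whose side at [x] is as small as possible has a single cycle as
   side, for lack of pendant vertices. *)
Lemma leaf_cycle_exists e a b : simple_graph e -> cycles_disjoint e -> e a b ->
  (forall u v, ~ pendant e u v) -> exists x p, leaf_cycle e x p.
Proof.
move=> se de eab np; have [es ei] := se.
have cse x y : connect_sym (edel e x y).
  by apply: sym_connect_sym; case: (simple_edel x y se).
pose side (z : V * V) := connect (edel e z.1 z.2) z.1.
pose bridge z := e z.1 z.2 && ~~ side z z.2.
have K s c d : is_cycle e s -> c \in s -> d \notin s -> e c d -> bridge (c, d).
  move=> cs sc sd ecd; rewrite /bridge ecd; apply: contra sd; rewrite /side /= cse.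
  by case/(lone_cycle_mem se (lone_cycle_disjoint de cs) sc ecd).
have [z0 bz0|nb] := pickP bridge; last first.
  have [[|x p] cs] := cycle_exists se eab np; first by case/andP: cs.
  exists x, p; split; first exact: lone_cycle_disjoint.
  left=> c d sc ecd; apply/negPn/negP => sd.
  by have := nb (c, d); rewrite (K _ _ _ cs).
have [[x y] /= /andP[/= exy nxy] minxy] :=
  @arg_minnP _ z0 bridge (fun z => #|side z|) bz0.
have M c d : e c d -> side (x, y) c -> ~ (c = x /\ d = y) ->
    ~~ connect (edel e c d) d x -> bridge (c, d) -> False.
  move=> ecd xc ncd ndx /andP[/= _ ncd'].
  have EC : edel e d c = edel e c d.
    by apply: relext => k l; rewrite /edel [[set d; c]]setUC.
  have bdc : bridge (d, c) by rewrite /bridge /side /= es ecd EC cse.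
  have := minxy _ bdc; apply/negP; rewrite -ltnNge; apply: proper_card.
  apply/properP; split; last first.
    by exists c; [exact: xc | rewrite -topredE /= /side /= EC cse].
  apply/subsetP=> w; rewrite !unfold_in /side /= EC => dw.
  apply: connect_trans xc (connect_trans (connect1 (y := d) _) _).
    rewrite /edel ecd; apply/eqP=> /set2_eq[//|[_ dx]].
    by rewrite dx connect0 in ndx.
  apply: connect_reached dw => k l /andP[ekl _] dk dl; rewrite /edel ekl.
  by apply: contraNneq ndx => /set2_eq[[/= kE _]|[_ /= lE]];
    [rewrite -kE | rewrite -lE].
have [z exz zy] := not_pendant (np x y) exy.
have nbxz : ~~ bridge (x, z).
  apply/negP=> bxz; apply: (M x z exz _ _ _ bxz); rewrite /side /=.
  - by rewrite connect0.
  - by case=> _ zE; rewrite zE eqxx in zy.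
  - by case/andP: bxz => _; rewrite /side /= cse.
have : connect (edel e x z) z x.
  by move: nbxz; rewrite /bridge /side /= exz negbK cse.
case/(cycle_of_connect ei exz)=> q cs; exists x, (z :: q).
set s := x :: _ in cs *; have xs : x \in s by rewrite mem_head.
have ls := lone_cycle_disjoint de cs; split=> //.
have ys : y \notin s.
  by apply: contra nxy => ys; rewrite /side /= cse (chord_connect es cs xs ys).
have cs' c d : d \notin s -> is_cycle (edel e c d) s.
  move=> sd; apply: is_cycle_homo cs => k sk ekl; rewrite /edel ekl.
  apply: contraNneq sd => E; have : d \in [set k; next s k] by rewrite E set22.
  by case/set2P=> ->; rewrite ?mem_next.
right; exists y; split=> // c d sc sd ecd.
have [/andP[/eqP-> /eqP->]//|ncd] := boolP ((c == x) && (d == y)).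
have bcd := K _ _ _ cs sc sd ecd; exfalso; apply: (M c d) => //.
- rewrite /side /=; have /and3P[_ _ /connect_cycle] := cs' x y ys.
  by apply.
- by case=> cx dy; rewrite cx dy !eqxx in ncd.
case/andP: bcd => _; apply: contra => dx; rewrite /side /= cse.
have /and3P[_ _ /connect_cycle xc] := cs' c d sd.
exact: connect_trans dx (xc _ _ xs sc).
Qed.

End Leaves.

(** * Reducible graphs *)

Section Reduction.

Variable V : finType.
Implicit Types (e : rel V) (s t p : seq V) (S R : {set V}).

Definition cyclic_vertices e := [set x | on_cycle e x].

(* [R] meets every cycle at most once: the matchings of the subgraph induced by
   [R] are, up to the choice of the endpoints on the cycles, the matchings of
   the contracted graph. *)
Definition partial_transversal e R :=
  forall x y, x \in R -> y \in R -> on_same_cycle e x y -> x = y.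

Definition non_isolated e := [set x | [exists y, e x y]].

Lemma card_non_isolated_vdel e S x y : x \in S -> e x y ->
  #|non_isolated (vdel e S)| < #|non_isolated e|.
Proof.
move=> xS exy; apply: proper_card; apply/properP; split.
  apply/subsetP=> a; rewrite !inE => /existsP[b /vdel_sub eab].
  by apply/existsP; exists b.
exists x; rewrite inE; first by apply/existsP; exists y.
by apply/existsP=> -[b /and3P[_]]; rewrite xS.
Qed.

Lemma on_cycle_same e x : on_cycle e x = on_same_cycle e x x.
Proof.
apply/on_cycleP/on_same_cycleP => [[s cs xs]|[s [cs xs _]]]; by exists s.
Qed.

Lemma on_same_cycleC e x y : on_same_cycle e x y = on_same_cycle e y x.
Proof. by apply: eq_existsb => B; rewrite [(x \in B) && _]andbC. Qed.

Lemma on_same_cyclel e x y : on_same_cycle e x y -> on_cycle e x.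
Proof.
by case/on_same_cycleP=> s [cs xs _]; apply/on_cycleP; exists s.
Qed.

Lemma on_same_cycler e x y : on_same_cycle e x y -> on_cycle e y.
Proof. by rewrite on_same_cycleC => /on_same_cyclel. Qed.

Lemma on_same_cycle_vdel e S x y :
  on_same_cycle (vdel e S) x y -> on_same_cycle e x y.
Proof.
case/on_same_cycleP=> s [/is_cycle_vdel[cs _] xs ys].
by apply/on_same_cycleP; exists s.
Qed.

Lemma is_cycle_vdel1 e v s : ~~ on_cycle e v -> is_cycle e s ->
  is_cycle (vdel e [set v]) s.
Proof.
move=> nv cs; apply/is_cycle_vdel; split=> //.
rewrite disjoint_subset; apply/subsetP=> x xs; rewrite !inE.
by apply: contraNneq nv => <-; apply/on_cycleP; exists s.
Qed.

Lemma on_same_cycle_vdel1 e v x y : ~~ on_cycle e v ->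
  on_same_cycle (vdel e [set v]) x y = on_same_cycle e x y.
Proof.
move=> nv; apply/idP/idP; first exact: on_same_cycle_vdel.
case/on_same_cycleP=> s [cs xs ys]; apply/on_same_cycleP; exists s.
by split=> //; apply: is_cycle_vdel1.
Qed.

Lemma cyclic_vertices_vdel1 e v : ~~ on_cycle e v ->
  cyclic_vertices (vdel e [set v]) = cyclic_vertices e.
Proof.
by move=> nv; apply/setP=> x; rewrite !inE !on_cycle_same on_same_cycle_vdel1.
Qed.

Lemma lone_cycle_other e s t x : lone_cycle e s -> is_cycle e t -> x \in t ->
  x \notin s -> is_cycle (vdel e [set x in s]) t.
Proof.
move=> [cs ls] ct xt xs; apply/is_cycle_vdel; split=> //.
rewrite disjoint_subset; apply/subsetP=> y yt; rewrite !inE; apply/negP=> ys.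
by rewrite -(cycle_edges_mem (ls t y ct ys yt)) xt in xs.
Qed.

Lemma on_same_cycle_lone e s x y : lone_cycle e s -> x \notin s ->
  on_same_cycle (vdel e [set x in s]) x y = on_same_cycle e x y.
Proof.
move=> ls xs; apply/idP/idP; first exact: on_same_cycle_vdel.
case/on_same_cycleP=> t [ct xt yt]; apply/on_same_cycleP; exists t.
by split=> //; apply: lone_cycle_other xs.
Qed.

Lemma vdel_cyclic_lone e s : lone_cycle e s ->
  vdel (vdel e [set x in s]) (cyclic_vertices (vdel e [set x in s]))
    = vdel e (cyclic_vertices e).
Proof.
move=> ls; rewrite vdelU; congr (vdel e _); apply/setP=> x; rewrite !inE.
have [xs|xs] := boolP (x \in s).
  by apply/esym/on_cycleP; exists s; case: ls.
by rewrite /= !on_cycle_same on_same_cycle_lone.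
Qed.

Lemma matching_number_lone_cycle e s : irreflexive e -> closed_in e s ->
  symmetric e -> uniq s -> odd (size s) ->
  matching_number e <= matching_number (vdel e [set x in s]) + (size s).-1./2.
Proof.
move=> ei cls es us os.
apply: leq_trans (matching_number_closed (S := [set x in s]) ei _) _.
  by move=> x y exy; rewrite !inE; apply/idP/idP => xs; apply: cls xs _;
    rewrite // es.
by rewrite leq_add2l cardsE (card_uniqP us); lia.
Qed.

Variable good : seq V -> Prop.

Inductive reducible : rel V -> Prop :=
| Reducible0 e : (forall x y, ~~ e x y) -> reducible e
| ReduciblePendant e u v : pendant e u v -> ~~ on_cycle e v ->
    reducible (vdel e [set v]) -> reducible e
| ReducibleCycle e s : lone_cycle e s -> closed_in e s ->
    (forall t, is_cycle e t -> cycle_edges t = cycle_edges s -> good t) ->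
    reducible (vdel e [set x in s]) -> reducible e.

(* If a cycle is attached to [w] by an edge, then the first clause contradicts
   extremality, and the second one condition (iii). *)
Definition missable e w :=
  matching_number e <= matching_number (vdel e [set w]) /\
  exists R, [/\ partial_transversal e R,
    forall z, z \in R -> z != w /\ ~~ on_same_cycle e z w &
    matching_number (vdel e (cyclic_vertices e))
      <= matching_number (vdel e (~: R))].

Lemma noncyclic_transversal e : partial_transversal e (~: cyclic_vertices e).
Proof.
by move=> x y; rewrite !inE => /negbTE nx _ /on_same_cyclel; rewrite nx.
Qed.

Lemma partial_transversalU e v R : ~~ on_cycle e v ->
  partial_transversal e R -> partial_transversal e (v |: R).
Proof.
move=> nv tR x y /setU1P[->|xR] /setU1P[->|yR] //; last exact: tR.
  by move/on_same_cyclel; rewrite (negbTE nv).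
by move/on_same_cycler; rewrite (negbTE nv).
Qed.

Lemma matching_number_add_transversal e e' R R' a b :
    e a b -> a \in R -> b \in R ->
    (forall x y, e' x y -> x \in R' -> y \in R' ->
       [/\ e x y, x \in R, y \in R & [/\ x != a, x != b, y != a & y != b]]) ->
  (matching_number (vdel e' (~: R'))).+1 <= matching_number (vdel e (~: R)).
Proof.
move=> eab aR bR H.
apply: leq_trans (matching_number_add_edge (a := a) (b := b) _); last first.
  by rewrite /vdel eab !inE aR bR.
rewrite ltnS; apply: matching_number_homo => x y /and3P[exy].
rewrite !inE !negbK => xR yR; have [h1 h2 h3 [h4 h5 h6 h7]] := H _ _ exy xR yR.
by rewrite /vdel h1 !inE !negb_or !negbK h2 h3 h4 h5 h6 h7.
Qed.

Hypothesis good_odd : forall s, good s -> odd (size s).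

Lemma missable_pendant_self e u v w : simple_graph e -> pendant e u v ->
    ~~ on_cycle e v -> e v w -> w != u -> missable (vdel e [set v]) w ->
  missable e u.
Proof.
move=> se [euv uv] nv evw wu [mw [R [tR Rw mR]]]; have [es ei] := se.
have nu := pendant_noncyclic se (conj euv uv).
have vu : v != u by apply: contraTneq euv => ->; rewrite ei.
have vw : v != w by apply: contraTneq evw => ->; rewrite ei.
have pu x y : e x y -> x != v -> y != v -> (x != u) && (y != u).
  move=> exy xv yv; apply/andP; split.
    by apply: contraNneq yv => xu; apply/eqP/uv; rewrite -xu.
  by apply: contraNneq xv => yu; apply/eqP/uv; rewrite -yu es.
split.
  have := matching_number_vdel_geq e [set v]; rewrite cards1 addn1.
  move/leq_trans; apply; apply: leq_trans (_ : _ <=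
    (matching_number (vdel (vdel e [set v]) [set w])).+1) _; first by [].
  apply: leq_trans (matching_number_add_edge (a := v) (b := w) _); last first.
    by rewrite /vdel evw !inE vu wu.
  rewrite ltnS; apply: matching_number_homo => x y.
  rewrite /vdel !inE !negb_or => /and3P[/and3P[exy xv yv] xw yw].
  by have /andP[xu yu] := pu _ _ exy xv yv; rewrite exy xv yv xw yw xu yu.
exists (v |: (w |: (R :\ u))); split.
- apply: partial_transversalU => // x y /setU1P[->|/setD1P[xu xR]].
    move=> /setU1P[->//|/setD1P[yu yR]]; rewrite on_same_cycleC => ywc.
    by have [_] := Rw y yR; rewrite on_same_cycle_vdel1 // ywc.
  move=> /setU1P[->|/setD1P[yu yR]].
    move=> xwc.
    by have [_] := Rw x xR; rewrite on_same_cycle_vdel1 // xwc.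
  by rewrite -(on_same_cycle_vdel1 _ _ nv); apply: tR.
- move=> z zR; split.
    by move: zR; rewrite !inE => /or3P[/eqP->|/eqP->|/andP[]].
  by apply: contra nu => /on_same_cycler.
have := matching_number_vdel_geq (vdel e (cyclic_vertices e)) [set v].
rewrite vdelC -{2}(cyclic_vertices_vdel1 nv) cards1 addn1 => /leq_trans; apply.
apply: leq_ltn_trans mR _.
apply: (@matching_number_add_transversal _ _ _ _ v w) => //.
- by rewrite !inE eqxx.
- by rewrite !inE eqxx orbT.
move=> x y /and3P[exy]; rewrite !inE => xv yv xR yR.
have /andP[xu yu] := pu _ _ exy xv yv.
by rewrite xu yu xR yR !orbT xv yv; split=> //; split=> //; [case: (Rw x)|case: (Rw y)].
Qed.

Lemma missable_pendant_other e u v w : simple_graph e -> pendant e u v ->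
    ~~ on_cycle e v -> w != u -> w != v -> missable (vdel e [set v]) w ->
  missable e w.
Proof.
move=> se [euv uv] nv wu wv [mw [R [tR Rw mR]]]; have [es ei] := se.
have nu := pendant_noncyclic se (conj euv uv).
split.
  have := matching_number_vdel_geq e [set v]; rewrite cards1 addn1.
  move/leq_trans; apply.
  apply: leq_ltn_trans mw _; rewrite vdelC.
  apply: (@matching_number_pendant _ _ u); first by case: (simple_vdel [set w] se).
  split=> [|z /vdel_sub/uv //].
  by rewrite /vdel euv !inE ![_ == w]eq_sym wu wv.
exists (u |: (v |: R)); split.
- do 2![apply: partial_transversalU => //] => x y xR yR.
  by rewrite -(on_same_cycle_vdel1 _ _ nv); apply: tR.
- move=> z /setU1P[->|/setU1P[->|/Rw]].
  + by rewrite eq_sym; split=> //; apply: contra nu => /on_same_cyclel.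
  + by rewrite eq_sym; split=> //; apply: contra nv => /on_same_cyclel.
  + by rewrite on_same_cycle_vdel1.
have := matching_number_vdel_geq (vdel e (cyclic_vertices e)) [set v].
rewrite vdelC -{2}(cyclic_vertices_vdel1 nv) cards1 addn1 => /leq_trans; apply.
apply: leq_ltn_trans mR _.
apply: (@matching_number_add_transversal _ _ _ _ u v) => //.
- by rewrite !inE eqxx.
- by rewrite !inE eqxx orbT.
move=> x y /and3P[exy]; rewrite !inE => xv yv xR yR.
rewrite xR yR !orbT xv yv; split=> //; split=> //.
  by apply: contraNneq yv => xu; apply/eqP/uv; rewrite -xu.
by apply: contraNneq xv => yu; apply/eqP/uv; rewrite -yu es.
Qed.

Lemma missable_on_cycle e s w : simple_graph e -> lone_cycle e s ->
  closed_in e s -> odd (size s) -> w \in s -> missable e w.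
Proof.
move=> [es ei] ls cls os ws; have [cs _] := ls.
have /and3P[_ us _] := cs.
split.
  apply: leq_trans (matching_number_lone_cycle ei cls es us os) _.
  have [i p sE] := rot_to ws.
  have : uniq (w :: p) by rewrite -sE rot_uniq.
  have : is_cycle e (w :: p) by rewrite -sE is_cycle_rot.
  case/and3P=> _ _; rewrite /= rcons_path => /andP[pp _] /andP[wp up].
  have sp : size s = (size p).+1 by rewrite -(size_rot i) sE.
  rewrite (_ : [set x in s] = [set w] :|: [set x in p]); last first.
    by apply/setP=> x; rewrite inE -(mem_rot i) sE !inE.
  rewrite sp /= -vdelU; apply: matching_number_path => //.
  apply: (sub_in_sorted (P := [in p])); last exact: path_sorted pp.
    move=> x y xp yp exy; rewrite /vdel exy !inE /=.
    by apply/andP; split; [apply: contraTneq xp|apply: contraTneq yp] => ->.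
  exact: allss.
exists (~: cyclic_vertices e); split; first exact: noncyclic_transversal.
- move=> z; rewrite !inE => nz; split; last by apply: contra nz => /on_same_cyclel.
  by apply: contraNneq nz => ->; apply/on_cycleP; exists s.
by rewrite setCK.
Qed.

Lemma cycle_sorted e s : is_cycle e s -> sorted e s.
Proof. by case: s => // x s /and3P[_ _]; rewrite /= rcons_path => /andP[]. Qed.

Lemma missable_off_cycle e s w : simple_graph e -> lone_cycle e s ->
    closed_in e s -> odd (size s) -> w \notin s ->
  missable (vdel e [set x in s]) w -> missable e w.
Proof.
move=> [es ei] ls cls os ws [mw [R [tR Rw mR]]]; have [cs _] := ls.
have /and3P[_ us _] := cs.
split.
  apply: leq_trans (matching_number_lone_cycle ei cls es us os) _.
  apply: leq_trans (_ : _ <=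
    matching_number (vdel (vdel e [set w]) [set x in s]) + (size s)./2) _.
    by rewrite vdelC leq_add //; lia.
  apply: matching_number_path => //.
  apply: (sub_in_sorted (P := [in s])); last exact: cycle_sorted cs.
    move=> x y xp yp exy; rewrite /vdel exy !inE /=.
    by apply/andP; split; [apply: contraTneq xp|apply: contraTneq yp] => ->.
  exact: allss.
exists (R :\: [set x in s]); split.
- move=> x y; rewrite !inE => /andP[xs xR] /andP[ys yR].
  by rewrite -(on_same_cycle_lone _ ls xs); apply: tR.
- move=> z; rewrite !inE => /andP[zs zR]; have [zw] := Rw z zR.
  by rewrite (on_same_cycle_lone _ ls zs).
rewrite -(vdel_cyclic_lone ls); apply: leq_trans mR _.
apply: matching_number_homo => x y; rewrite /vdel !inE !negbK.
by case/and3P=> /and3P[-> -> ->] -> ->.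
Qed.

Lemma reducible_missable e w : simple_graph e -> reducible e ->
    (forall z t : V, connect e w z -> pendant e z t -> z = w) ->
  missable e w.
Proof.
move=> se re; elim: re w se => {e} [e e0|e u v puv nv re IH|e s ls cls gs re IH] w se Hw.
- split; first by rewrite matching_number0.
  exists set0; split=> [x y||]; rewrite ?inE //; first by move=> z; rewrite inE.
  by rewrite matching_number0 // => x y; apply/negP=> /vdel_sub; apply/negP.
- have [es ei] := se; have [euv uv] := puv; set e' := vdel e [set v] in re IH *.
  have se' : simple_graph e' by apply: simple_vdel.
  have ee : subrel (connect e') (connect e).
    by apply: connect_sub => a b /vdel_sub; apply: connect1.
  have [wu|wu] := eqVneq w u.
    subst w; have [w evw wu] : exists2 w, e v w & w != u.
      apply: not_pendant; last by rewrite es.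
      by move=> pv; have /eqP := Hw v u (connect1 euv) pv; apply/negP;
        apply: contraTneq euv => ->; rewrite ei.
    apply: (missable_pendant_self se puv nv evw wu); apply: IH => // z t wz [e'zt zt].
    apply/eqP; apply/negPn/negP => zw.
    have [ezt zv tv] : [/\ e z t, z != v & t != v].
      by case/and3P: e'zt; rewrite !inE.
    have uz : connect e u z.
      by apply: connect_trans (connect1 euv) (connect_trans (connect1 evw) (ee _ _ wz)).
    have zu : z != u.
      apply: contraTneq e'zt => ->; apply/negP=> /and3P[/uv->].
      by rewrite !inE eqxx.
    have [b ezb bt] : exists2 b, e z b & b != t.
      by apply: not_pendant => // /(Hw _ _ uz)/eqP; apply/negP.
    have bv : b = v.
      apply/eqP; apply/negPn/negP => bv; move: bt; rewrite (zt b) ?eqxx //.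
      by rewrite /e' /vdel ezb !inE zv.
    subst b; have := on_cycle_edge se nv evw.
    rewrite (sym_connect_sym (proj1 (simple_edel _ _ se))); apply/negP; rewrite negbK.
    apply: connect_trans (_ : connect _ w z) (connect1 _).
      apply: connect_sub wz => c d /and3P[ecd]; rewrite !inE => cv dv.
      apply: connect1; rewrite /edel ecd; 
        apply: contraNneq cv => /set2_eq[[-> _]//|[_ dE]].
      by rewrite dE eqxx in dv.
    rewrite /edel ezb; apply: contraNneq zw => /set2_eq[[zE vw]|[-> _]//].
    by rewrite zE eqxx in zv.
  have nwu : ~~ connect e w u by apply: contraNN wu => /Hw/(_ puv) ->.
  have nwv : ~~ connect e w v.
    by apply: contra nwu => /connect_trans; apply; apply: connect1; rewrite es.
  apply: (missable_pendant_other se puv nv wu).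
    by apply: contraNneq nwv => ->.
  apply: IH => // z t wz [e'zt zt]; have {wz}wz := ee _ _ wz.
  apply: (Hw z t wz); split=> [|b ezb]; first exact: vdel_sub e'zt.
  have /and3P[_] := e'zt; rewrite !inE => zv _.
  apply: zt; rewrite /e' /vdel ezb !inE zv /=; apply: contraNneq nwv => <-.
  exact: connect_trans wz (connect1 ezb).
have os : odd (size s) by apply/good_odd/gs => //; case: ls.
have [ws|ws] := boolP (w \in s); first exact: (@missable_on_cycle e s).
apply: (@missable_off_cycle e s) => //; apply: IH => //.
  exact: simple_vdel.
have ee : subrel (connect (vdel e [set x in s])) (connect e).
  by apply: connect_sub => a b /vdel_sub; apply: connect1.
move=> z t /ee wz [e'zt zt]; apply: (Hw z t wz); split; first exact: vdel_sub e'zt.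
move=> b ezb; apply: zt; have /and3P[_] := e'zt; rewrite /vdel ezb !inE => zs _.
rewrite zs; apply: contra zs => bs; apply: cls bs _; by rewrite (proj1 se).
Qed.

Section ReducibleOf.

Variable P : rel V -> Prop.

Hypothesis P_pendant : forall e u v, simple_graph e -> P e -> pendant e u v ->
  ~~ on_cycle e v /\ P (vdel e [set v]).
Hypothesis P_disjoint : forall e, simple_graph e -> P e -> cycles_disjoint e.
Hypothesis P_leaf : forall e x p, simple_graph e -> P e -> leaf_cycle e x p ->
  P (vdel e [set z in x :: p]).
Hypothesis P_attached : forall e x p y, simple_graph e -> P e ->
  leaf_cycle e x p -> e x y -> y \notin x :: p ->
  ~ missable (vdel e [set z in x :: p]) y.
Hypothesis P_good : forall e s, simple_graph e -> P e -> lone_cycle e s ->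
  closed_in e s -> good s.

Lemma reducible_of e : simple_graph e -> P e -> reducible e.
Proof.
have [n] := ubnP #|non_isolated e|; elim: n e => // n IH e en se Pe.
have IHd S x y : x \in S -> e x y -> P (vdel e S) -> reducible (vdel e S).
  move=> xS exy; apply: IH; last exact: simple_vdel.
  exact: leq_trans (card_non_isolated_vdel xS exy) _.
have [[x y] /= exy|e0] := pickP (fun z : V * V => e z.1 z.2); last first.
  by apply: Reducible0 => x y; have /= -> := e0 (x, y).
have [[u v] /= /andP[euv /forallP uv]|np] :=
    pickP (fun z : V * V => e z.1 z.2 && [forall t, e z.1 t ==> (t == z.2)]).
  have puv : pendant e u v.
    by split=> // z euz; apply/eqP; have := uv z; rewrite euz.
  have [nv Pv] := P_pendant se Pe puv.
  apply: ReduciblePendant puv nv _; apply: (IHd _ v u) => //; first exact: set11.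
  by rewrite (proj1 se).
have np' u v : ~ pendant e u v.
  move=> [euv uv]; have /negP := negbT (np (u, v)); apply => /=.
  by rewrite euv; apply/forallP=> t; apply/implyP=> /uv->.
have [c [p lc]] := leaf_cycle_exists se (P_disjoint se Pe) exy np'.
have Pl := P_leaf se Pe lc; have [ls _] := lc.
have cp : c \in c :: p by rewrite mem_head.
have rl : reducible (vdel e [set z in c :: p]).
  apply: (IHd _ c (next (c :: p) c)) => //; first by rewrite inE.
  by apply: is_cycle_next => //; case: ls.
case: (lc) => _ [cls|[d [ecd dcp att]]].
  apply: (ReducibleCycle ls cls _ rl) => t ct tE; apply: (P_good se Pe).
    split=> // t' z ct' zt zt'; rewrite tE.
    by apply: (proj2 ls) zt'; rewrite // -(cycle_edges_mem tE).
  by move=> a b; rewrite !(cycle_edges_mem tE); apply: cls.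
case: (P_attached se Pe lc ecd dcp).
apply: reducible_missable => //; first exact: simple_vdel.
move=> z t _ [/and3P[ezt]]; rewrite ![_ \in [set _ in _]]inE => zcp tcp zt.
have [b ezb bt] := not_pendant (np' z t) ezt.
have [bcp|bcp] := boolP (b \in c :: p).
  by have [] := att b z bcp zcp _; rewrite // (proj1 se).
by move: bt; rewrite (zt b) ?eqxx // /vdel ezb ![_ \in [set _ in _]]inE zcp.
Qed.

End ReducibleOf.

End Reduction.

Section Combinatorial.

Variable V : finType.
Implicit Types (e : rel V) (s t p : seq V) (S R : {set V}).

Variable good : seq V -> Prop.

Definition combinatorial_condition e :=
  [/\ cycles_disjoint e, forall s, is_cycle e s -> good s &
    forall R, partial_transversal e R -> matching_number (vdel e (~: R))
      <= matching_number (vdel e (cyclic_vertices e))].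

Lemma cycles_disjoint_vdel e S : cycles_disjoint e -> cycles_disjoint (vdel e S).
Proof.
by move=> de s t /is_cycle_vdel[cs _] /is_cycle_vdel[ct _]; apply: de.
Qed.

Lemma condition_pendant e u v : simple_graph e -> combinatorial_condition e ->
    pendant e u v ->
  ~~ on_cycle e v /\ combinatorial_condition (vdel e [set v]).
Proof.
move=> se [de ge me] puv; have [es ei] := se; have [euv uv] := puv.
have nu := pendant_noncyclic se puv.
have nv : ~~ on_cycle e v.
  apply/negP=> cv; suff : matching_number (vdel e (cyclic_vertices e))
      < matching_number (vdel e (cyclic_vertices e)) by rewrite ltnn.
  apply: leq_trans (me (v |: ~: cyclic_vertices e) _); last first.
    move=> x y /setU1P[->|xR] /setU1P[->|yR] //; last exact: noncyclic_transversal.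
      by move/on_same_cycler; move: yR; rewrite !inE => /negbTE->.
    by move/on_same_cyclel; move: xR; rewrite !inE => /negbTE->.
  rewrite -[in X in X < _](setCK (cyclic_vertices e)).
  apply: (@matching_number_add_transversal _ _ _ _ _ u v) => //.
  - by rewrite !inE nu orbT.
  - by rewrite !inE eqxx.
  move=> x y exy; rewrite !inE => nx ny; rewrite nx ny !orbT; split=> //.
  have xv : x != v by apply: contraNneq nx => ->.
  have yv : y != v by apply: contraNneq ny => ->.
  split=> //; first by apply: contraNneq yv => xu; apply/eqP/uv; rewrite -xu.
  by apply: contraNneq xv => yu; apply/eqP/uv; rewrite -yu es.
split=> //; split; first exact: cycles_disjoint_vdel.
  by move=> s /is_cycle_vdel[cs _]; apply: ge.
move=> R tR; rewrite -ltnS.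
have tR' : partial_transversal e (u |: (v |: R)).
  do 2![apply: partial_transversalU => //] => x y xR yR.
  by rewrite -(on_same_cycle_vdel1 _ _ nv); apply: tR.
apply: leq_trans (leq_trans (me _ tR') _).
  apply: (@matching_number_add_transversal _ _ _ _ _ u v) => //.
  - by rewrite !inE eqxx.
  - by rewrite !inE eqxx orbT.
  move=> x y /and3P[exy]; rewrite !inE => xv yv xR yR.
  rewrite xR yR !orbT xv yv; split=> //; split=> //.
    by apply: contraNneq yv => xu; apply/eqP/uv; rewrite -xu.
  by apply: contraNneq xv => yu; apply/eqP/uv; rewrite -yu es.
have := matching_number_vdel_geq (vdel e (cyclic_vertices e)) [set v].
by rewrite vdelC -{2}(cyclic_vertices_vdel1 nv) cards1 addn1.
Qed.

Lemma condition_leaf e s : simple_graph e -> combinatorial_condition e ->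
  lone_cycle e s -> combinatorial_condition (vdel e [set z in s]).
Proof.
move=> se [de ge me] ls; split; first exact: cycles_disjoint_vdel.
  by move=> t /is_cycle_vdel[ct _]; apply: ge.
move=> R tR; rewrite vdel_cyclic_lone //.
apply: leq_trans (me (R :\: [set z in s]) _).
  apply: matching_number_homo => x y; rewrite /vdel !inE !negbK.
  by case/and3P=> /and3P[-> -> ->] -> ->.
move=> x y; rewrite !inE => /andP[xs xR] /andP[ys yR].
by rewrite -(on_same_cycle_lone _ ls xs); apply: tR.
Qed.

Lemma condition_attached e x p y : simple_graph e -> combinatorial_condition e ->
    leaf_cycle e x p -> e x y -> y \notin x :: p ->
  ~ missable (vdel e [set z in x :: p]) y.
Proof.
move=> se [de ge me] [ls _] exy yp [_ [R [tR Ry mR]]].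
set s := x :: p in ls yp tR Ry mR; have xs : x \in s by rewrite mem_head.
suff : matching_number (vdel e (cyclic_vertices e))
    < matching_number (vdel e (cyclic_vertices e)) by rewrite ltnn.
apply: leq_trans (me (x |: (y |: (R :\: [set z in s]))) _); last first.
  have no z w : z \in s -> w \notin s -> ~~ on_same_cycle e z w.
    move=> zs ws; rewrite on_same_cycleC -(on_same_cycle_lone _ ls ws).
    apply/negP=> /on_same_cycleP[t [/is_cycle_vdel[_ dt] _ zt]].
    by have := disjointFr dt zt; rewrite inE zs.
  have H z w : z \in s -> w \in y |: (R :\: [set z in s]) -> ~~ on_same_cycle e z w.
    by move=> zs; rewrite !inE => /orP[/eqP->|/andP[ws _]]; apply: no.
  have H' w : w \in R :\: [set z in s] -> ~~ on_same_cycle e w y.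
    rewrite !inE => /andP[ws wR]; have [_] := Ry w wR.
    by rewrite on_same_cycle_lone.
  move=> a b /setU1P[->|aR] /setU1P[->|bR] //.
  - by rewrite (negbTE (H _ _ xs bR)).
  - by rewrite on_same_cycleC (negbTE (H _ _ xs aR)).
  case/setU1P: aR => [->|aR]; case/setU1P: bR => [->|bR] //.
  - by rewrite on_same_cycleC (negbTE (H' _ bR)).
  - by rewrite (negbTE (H' _ aR)).
  move: aR bR; rewrite !inE => /andP[as_ aR] /andP[_ bR].
  by rewrite -(on_same_cycle_lone _ ls as_); apply: tR.
rewrite -(vdel_cyclic_lone ls); apply: leq_ltn_trans mR _.
apply: (@matching_number_add_transversal _ _ _ _ _ x y) => //.
- by rewrite !inE eqxx.
- by rewrite !inE eqxx orbT.
move=> a b /and3P[eab]; rewrite ![_ \in [set _ in _]]inE => sa sb aR bR.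
rewrite !inE; move: (sa) (sb); rewrite /s !inE !negb_or.
move=> /andP[ax ap] /andP[bx bp]; rewrite ax bx ap bp aR bR !orbT.
by split=> //; split=> //; [case: (Ry a)|case: (Ry b)].
Qed.

Lemma condition_reducible e : (forall s, good s -> odd (size s)) ->
  simple_graph e -> combinatorial_condition e -> reducible good e.
Proof.
move=> go; apply: (@reducible_of V good go combinatorial_condition).
- exact: condition_pendant.
- by move=> ? _ [].
- by move=> {}e x p se ce [ls _]; apply: condition_leaf.
- exact: condition_attached.
- by move=> {}e s _ [_ ge _] [cs _] _; apply: ge.
Qed.

Definition noncyclic_cover e S :=
  (forall x, x \in S -> ~~ on_cycle e x) /\
  (forall x y, e x y -> [|| x \in S, y \in S | on_same_cycle e x y]).

Lemma reducible_condition e : simple_graph e -> reducible good e ->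
  [/\ cycles_disjoint e, forall s, is_cycle e s -> good s &
    exists2 S, noncyclic_cover e S &
      #|S| <= matching_number (vdel e (cyclic_vertices e))].
Proof.
move=> se re; elim: re se => {e} [e e0|e u v puv nv re IH|e s ls cls gs re IH] se.
- have nc s : ~ is_cycle e s.
    case: s => [/andP[]//|x s] cs; have := is_cycle_next cs (mem_head _ _).
    exact/negP/e0.
  split; [by move=> s t /nc | by move=> s /nc | exists set0; last by rewrite cards0].
  by split=> [x|x y exy]; [rewrite inE | have := e0 x y; rewrite exy].
- have [] := IH (simple_vdel _ se) => de ge [S [nS cS] mS].
  split=> [s t cs ct|s cs|].
  + by apply: de; apply: is_cycle_vdel1.
  + by apply: ge; apply: is_cycle_vdel1.
  have nS' x : x \in S -> ~~ on_cycle e x.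
    by move/nS; rewrite !on_cycle_same on_same_cycle_vdel1.
  have [es _] := se; have [euv uv] := puv.
  exists (v |: S); first split.
  + by move=> x /setU1P[->//|/nS'].
  + move=> x y exy; rewrite !inE.
    case: eqP => //= /eqP xv; case: (eqVneq y v) => [|yv]; first by rewrite orbT.
    rewrite -(on_same_cycle_vdel1 _ _ nv) /=; apply: cS.
    by rewrite /vdel exy !inE xv.
  apply: (@leq_trans #|S|.+1).
    by rewrite cardsU1; case: (v \in S) => //=; rewrite add0n.
  apply: leq_ltn_trans mS _; rewrite cyclic_vertices_vdel1 // vdelC.
  apply: (@matching_number_pendant _ _ u).
    by case: (simple_vdel (cyclic_vertices e) se).
  have nu := pendant_noncyclic se puv.
  by split=> [|z /vdel_sub/uv //]; rewrite /vdel euv !inE nu nv.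
have [] := IH (simple_vdel _ se) => de ge [S [nS cS] mS].
have other t : is_cycle e t -> cycle_edges t != cycle_edges s ->
    is_cycle (vdel e [set x in s]) t.
  move=> ct ts; apply/is_cycle_vdel; split=> //.
  rewrite disjoint_subset; apply/subsetP=> y yt; rewrite !inE.
  by apply: contra ts => ys; apply/eqP; apply: (proj2 ls) ys yt.
have [es ei] := se.
split=> [t1 t2 c1 c2 n12|t ct|].
- have [E1|n1] := eqVneq (cycle_edges t1) (cycle_edges s).
    have c2' : is_cycle (vdel e [set x in s]) t2.
      by apply: other => //; rewrite -E1 eq_sym.
    have /is_cycle_vdel[_] := c2'; rewrite disjoint_sym.
    rewrite !disjoint_subset => /subsetP d2; apply/subsetP=> x.
    by rewrite (cycle_edges_mem E1) => xs; apply: d2; rewrite inE.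
  have c1' := other _ c1 n1.
  have [E2|n2] := eqVneq (cycle_edges t2) (cycle_edges s).
    have /is_cycle_vdel[_] := c1'.
    rewrite !disjoint_subset => /subsetP d2; apply/subsetP=> x /d2.
    by rewrite !inE (cycle_edges_mem E2).
  by apply: de => //; apply: other.
- have [E|n] := eqVneq (cycle_edges t) (cycle_edges s); first exact: gs.
  exact/ge/other.
exists (S :\: [set x in s]); first split.
- move=> x; rewrite !inE => /andP[xs /nS].
  by rewrite !on_cycle_same on_same_cycle_lone.
- move=> x y exy; rewrite !inE.
  have [xs|xs] := boolP (x \in s).
    have ys := cls _ _ xs exy; rewrite ys /=; apply/on_same_cycleP.
    by exists s; split=> //; case: ls.
  have [ys|ys] := boolP (y \in s).
    by rewrite (cls y x ys) // es in xs.
  rewrite /= -(on_same_cycle_lone _ ls xs); apply: cS.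
  by rewrite /vdel exy !inE xs.
rewrite -(vdel_cyclic_lone ls); apply: leq_trans mS.
exact/subset_leq_card/subsetDl.
Qed.

End Combinatorial.

Section Contraction.

Variables (V : finType) (e : rel V).
Hypothesis se : simple_graph e.

Lemma contraction_class_exists x :
  exists u : contraction_vertex e, x \in contraction_fiber u.
Proof.
have [/existsP[B /andP[cB xB]]|ncx] := boolP (on_cycle e x).
  by exists (inl (exist _ B cB)).
by exists (inr (exist _ x ncx)); rewrite /= inE.
Qed.

Definition contraction_class x := xchoose (contraction_class_exists x).

Lemma mem_contraction_class x : x \in contraction_fiber (contraction_class x).
Proof. exact: (xchooseP (contraction_class_exists x)). Qed.

Lemma contraction_fiber_same (u : contraction_vertex e) x y :
  x \in contraction_fiber u -> y \in contraction_fiber u ->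
  x = y \/ on_same_cycle e x y.
Proof.
case: u => [[B cB]|z] /= xu yu; last by move: xu yu => /set1P-> /set1P->; left.
by right; apply/existsP; exists B; rewrite cB xu yu.
Qed.

Lemma contraction_fiber_noncyclic (u : contraction_vertex e) x :
  ~~ on_cycle e x -> x \in contraction_fiber u -> noncyclic_vertex u.
Proof.
case: u => [[B cB]|//] /= nx xB; case/negP: nx; apply/existsP; exists B.
by rewrite cB.
Qed.

Lemma matching_number_contraction_geq (R : {set V}) : partial_transversal e R ->
  matching_number (vdel e (~: R)) <= matching_number (contraction_edge e).
Proof.
move=> tR; have fi : {in R &, injective contraction_class}.
  move=> x y xR yR E; have := mem_contraction_class y; rewrite -E => yx.
  have [//|] := contraction_fiber_same (mem_contraction_class x) yx.
  exact: tR.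
apply: (matching_number_imset (f := contraction_class) (A := R)) => // x y.
case/and3P=> exy; rewrite !inE !negbK => xR yR; split=> //; apply/andP; split.
  by apply: contraTneq exy => /(fi _ _ xR yR)->; rewrite (proj2 se).
apply/existsP; exists x; rewrite mem_contraction_class.
by apply/existsP; exists y; rewrite mem_contraction_class.
Qed.

Lemma matching_number_contraction_leq (S : {set V}) :
  cycles_disjoint e -> noncyclic_cover e S ->
  matching_number (contraction_edge e) <= #|S|.
Proof.
move=> de [nS cS].
apply: leq_trans (leq_imset_card contraction_class S).
have fS (u : contraction_vertex e) x :
    x \in S -> x \in contraction_fiber u -> u \in contraction_class @: S.
  move=> xS; case: u => [u /(contraction_fiber_noncyclic (nS _ xS))//|z] xz.
  apply/imsetP; exists x => //; have nx := nS _ xS; have := mem_contraction_class x.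
  case: (contraction_class x) => [u /(contraction_fiber_noncyclic nx)//|z'].
  by move: xz => /set1P xz /set1P xz'; congr inr; apply: val_inj; rewrite -xz -xz'.
apply: matching_number_cover => u v /andP[uv /existsP[x /andP[xu /existsP[y]]]].
case/andP=> yv exy; case/or3P: (cS _ _ exy) => [xS|yS|].
- by rewrite (fS u x).
- by rewrite (fS v y) // orbT.
case/on_same_cycleP=> s [cs xs ys]; case/negP: uv; apply/eqP.
have Hcyc (w : contraction_vertex e) z : z \in s -> z \in contraction_fiber w ->
    exists2 B : {B : {set V} | is_cycle_set e B}, w = inl B & val B = [set x in s].
  move=> zs; case: w => [B|z'] /= zw.
    exists B => //; have /is_cycle_setP[t ct BE] := valP B.
    have : cycle_edges t = cycle_edges s.
      apply/eqP; apply/negPn/negP => n; have := de _ _ ct cs n.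
      move/disjointFl => /(_ z zs); rewrite BE inE in zw.
      by rewrite zw.
    by move=> /cycle_edges_mem ts; rewrite BE; apply/setP=> a; rewrite !inE ts.
  move: zw => /set1P zE; case/negP: (valP z'); apply/on_cycleP; exists s => //.
  by move: zs; rewrite zE.
have [B -> BE] := Hcyc _ _ xs xu; have [B' -> BE'] := Hcyc _ _ ys yv.
by congr inl; apply: val_inj; rewrite BE.
Qed.

Definition noncyclic_val (u : {u : contraction_vertex e | noncyclic_vertex u}) : V :=
  let: exist u nu := u in
  match u return noncyclic_vertex u -> V with
  | inl _ => fun nu => False_rect V (notF nu)
  | inr x => fun=> val x
  end nu.

Lemma noncyclic_val_inj : injective noncyclic_val.
Proof.
move=> [[?|x] nx] [[?|y] ny] //= xy; apply: val_inj => /=; congr inr.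
exact: val_inj.
Qed.

Lemma matching_number_contraction_noncyclic :
  matching_number (contraction_noncyclic e)
    = matching_number (vdel e (cyclic_vertices e)).
Proof.
have edgeE (x y : {x | ~~ on_cycle e x}) :
    contraction_edge e (inr x) (inr y) = e (val x) (val y).
  apply/andP/idP => [[_ /existsP[a /andP[/set1P-> /existsP[b]]]]|exy].
    by case/andP=> /set1P->.
  split; first by apply: contraTneq exy => -[->]; rewrite (proj2 se).
  apply/existsP; exists (val x); rewrite /= set11.
  by apply/existsP; exists (val y); rewrite /= set11.
apply/eqP; rewrite eqn_leq; apply/andP; split.
  apply: (matching_number_imset (f := noncyclic_val) (A := setT)).
    move=> [[?|x] nx] [[?|y] ny] //; rewrite /contraction_noncyclic /induced /= edgeE.
    by move=> exy; rewrite /vdel exy !inE (valP x) (valP y).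
  by move=> x y _ _; apply: noncyclic_val_inj.
apply: (matching_number_preimset noncyclic_val_inj) => x y /and3P[exy].
rewrite !inE => nx ny.
exists (exist _ (inr (exist _ x nx)) isT), (exist _ (inr (exist _ y ny)) isT).
by split=> //; rewrite /contraction_noncyclic /induced edgeE.
Qed.

End Contraction.

(** * Inertia *)

Import Order.TTheory GRing.Theory Num.Theory.
Local Open Scope ring_scope.


Section Inertia.

Local Open Scope sesquilinear_scope.

Variables (C : numClosedFieldType) (n : nat) (A : 'M[C]_n).
Hypothesis hA : A^t* = A.

Definition hermitian_value m (B : 'M[C]_m) (u : 'rV[C]_m) : C :=
  (u *m B *m u^t*) 0 0.

Let P := spectralmx A.
Let d := spectral_diag A.

Let hermA : A \is hermsymmx.
Proof. by rewrite qualifE /= expr0 scale1r hA. Qed.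

Let spectralA : A = P^t* *m diag_mx d *m P.
Proof.
have /orthomx_spectralP := hermitian_normalmx hermA.
by rewrite (invmx_unitary (spectral_unitarymx A)).
Qed.

Let dR i : d 0 i \is Num.real.
Proof. exact: (mxOverP (hermitian_spectral_diag_real hermA)). Qed.

Let hermitian_valueE u :
  hermitian_value A u = \sum_i d 0 i * `|(u *m P^t*) 0 i| ^+ 2.
Proof.
rewrite /hermitian_value {1}spectralA; set v := u *m P^t*.
have -> : u *m (P^t* *m diag_mx d *m P) *m u^t* = v *m diag_mx d *m v^t*.
  by rewrite /v trmx_mul map_mxM trmxCK !mulmxA.
rewrite mxE; apply: eq_bigr => i _.
by rewrite mul_mx_diag !mxE normCK mulrAC mulrC.
Qed.

Let pos := [set i | 0 < d 0 i].

Let inertiaE : count (fun z : C => 0 < z) (eigenvalues A) = #|pos|.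
Proof.
have PE : map_mx polyC P \in unitmx by rewrite map_unitmx spectral_unit.
have charE : char_poly A = \prod_(i < n) ('X - (d 0 i)%:P).
  have -> : \prod_(i < n) ('X - (d 0 i)%:P) = \prod_(i < n) ('X - (diag_mx d i i)%:P).
    by apply: eq_bigr => i _; rewrite mxE eqxx mulr1n.
  rewrite -char_poly_trig ?diag_mx_is_trig // /char_poly /char_poly_mx {1}spectralA.
  rewrite -(invmx_unitary (spectral_unitarymx A)) -/P !map_mxM map_invmx /=.
  set Q := map_mx _ P in PE *; set D := map_mx _ _.
  have -> : 'X%:M - invmx Q *m D *m Q = invmx Q *m ('X%:M - D) *m Q.
    by rewrite mulmxBr mulmxBl scalar_mxC mulmxKV.
  by rewrite !det_mulmx det_inv mulrAC mulVr ?mul1r // -unitmxE.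
have /prod_XsubC_eq/permP-> : \prod_(z <- eigenvalues A) ('X - z%:P)
    = \prod_(z <- [seq d 0 i | i <- enum 'I_n]) ('X - z%:P).
  by rewrite -char_poly_eigenvalues charE big_map big_enum.
rewrite count_map -sum1_count big_enum_cond sum1_card.
by apply: eq_card => i; rewrite !inE.
Qed.

Lemma inertia_witness : exists U : 'M_(count (fun z : C => 0 < z) (eigenvalues A), n),
  forall w, w != 0 -> 0 < hermitian_value A (w *m U).
Proof.
rewrite inertiaE; exists (rowsub (@enum_val _ pos) P) => w w0.
have wE i : (w *m rowsub (@enum_val _ pos) P *m P^t*) 0 i
    = \sum_j w 0 j *+ (enum_val j == i).
  rewrite -mulmxA mul_rowsub_mx (unitarymxP (spectral_unitarymx A)) mxE.
  by apply: eq_bigr => j _; rewrite !mxE mulr_natr.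
have [j wj] : exists j, w 0 j != 0.
  apply/existsP; apply: contraNT w0 => /existsPn w0; apply/eqP/rowP => j.
  by rewrite mxE; apply/eqP; have := w0 j; rewrite negbK.
rewrite hermitian_valueE (bigD1 (enum_val j)) //= wE.
have wj' : \sum_k w 0 k *+ (enum_val k == enum_val j) = w 0 j.
  rewrite (bigD1 j) //= eqxx big1 ?addr0 // => k kj.
  by rewrite (inj_eq enum_val_inj) (negbTE kj).
rewrite wj'; apply: ltr_pwDl.
  by rewrite mulr_gt0 ?exprn_gt0 ?normr_gt0 //; have := enum_valP j; rewrite inE.
apply: sumr_ge0 => i _; rewrite wE.
have [ip|ip] := boolP (i \in pos).
  by rewrite mulr_ge0 ?exprn_ge0 //; move: ip; rewrite inE => /ltW.
rewrite big1 ?normr0 ?expr0n ?mulr0 // => k _.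
by case: eqP => // ki; have := enum_valP k; rewrite ki (negbTE ip).
Qed.

Lemma inertia_geq k (U : 'M_(k, n)) :
    (forall w, w != 0 -> 0 < hermitian_value A (w *m U)) ->
  (k <= count (fun z : C => (0 < z)%R) (eigenvalues A))%N.
Proof.
move=> posU; rewrite inertiaE leqNgt; apply/negP => ltk.
pose M := colsub (@enum_val _ pos) (U *m P^t*).
have : kermx M != 0.
  by rewrite kermx_eq0 /row_free neq_ltn (leq_ltn_trans (rank_leq_col M) ltk).
case/rowV0Pn=> w /sub_kermxP wM w0; have := posU w w0.
apply/negP; rewrite -real_leNgt ?real0 //; last first.
  rewrite hermitian_valueE rpred_sum // => i _.
  by rewrite realM ?realX ?normr_real.
rewrite hermitian_valueE sumr_le0 // => i _.
have [ip|ip] := boolP (i \in pos).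
  have /matrixP/(_ 0 (enum_rank_in ip i)) := wM.
  rewrite /M mulmx_colsub mulmxA [LHS]mxE [RHS]mxE enum_rankK_in // => ->.
  by rewrite normr0 expr0n mulr0.
rewrite mulr_le0_ge0 ?exprn_ge0 //.
by rewrite inE -real_leNgt ?real0 in ip.
Qed.

End Inertia.

Section Forms.

Local Open Scope sesquilinear_scope.

Variables (C : numClosedFieldType) (V : finType).
Implicit Types (h : V -> V -> C) (f g : V -> C).

Definition hermitian_kernel h := forall x y, h y x = (h x y)^*.

Definition qform h f := \sum_x \sum_y f x * h x y * (f y)^*.

Definition lincomb k (w : 'I_k -> C) (F : 'I_k -> V -> C) x :=
  \sum_i w i * F i x.

Definition positive_family h k (F : 'I_k -> V -> C) :=
  forall w, (exists i, w i != 0) -> 0 < qform h (lincomb w F).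

Definition positive_dim h k := exists F : 'I_k -> V -> C, positive_family h F.

Definition form_matrix h : 'M[C]_#|V| :=
  \matrix_(k, l) h (enum_val k) (enum_val l).

Definition form_inertia h :=
  count (fun z : C => 0 < z) (eigenvalues (form_matrix h)).

Lemma form_matrix_hermitian h : hermitian_kernel h -> (form_matrix h)^t* = form_matrix h.
Proof. by move=> hh; apply/matrixP=> i j; rewrite !mxE -hh. Qed.

Lemma qform_matrix h f :
  qform h f = hermitian_value (form_matrix h) (\row_i f (enum_val i)).
Proof.
rewrite /hermitian_value mxE /qform.
rewrite exchange_big /= (reindex _ (onW_bij _ (enum_val_bij V))) /=.
apply: eq_bigr => i _; rewrite !mxE mulr_suml.
rewrite (reindex _ (onW_bij _ (enum_val_bij V))) /=.
by apply: eq_bigr => j _; rewrite !mxE.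
Qed.

Lemma positive_dim_inertia h : hermitian_kernel h -> positive_dim h (form_inertia h).
Proof.
move=> hh; have [U posU] := inertia_witness (form_matrix_hermitian hh).
exists (fun i x => U i (enum_rank x)) => w [i wi]; rewrite qform_matrix.
have -> : \row_j lincomb w (fun i x => U i (enum_rank x)) (enum_val j)
    = \row_i w i *m U.
  apply/rowP=> j; rewrite !mxE; apply: eq_bigr => k _.
  by rewrite enum_valK mxE.
apply: posU; apply: contraNneq wi => /rowP/(_ i); rewrite !mxE => ->.
exact: eqxx.
Qed.

Lemma positive_dim_leq h k : hermitian_kernel h -> positive_dim h k ->
  (k <= form_inertia h)%N.
Proof.
move=> hh [F posF]; pose U : 'M[C]_(k, #|V|) := \matrix_(i, j) F i (enum_val j).
apply: (inertia_geq (form_matrix_hermitian hh) (U := U)) => w w0.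
have -> : w *m U = \row_j lincomb (w 0) F (enum_val j).
  by apply/rowP=> j; rewrite !mxE; apply: eq_bigr => i _; rewrite !mxE.
rewrite -qform_matrix; apply: posF; apply/existsP; apply: contraNT w0.
move/existsPn=> w0; apply/eqP/rowP => i; rewrite mxE.
by apply/eqP; rewrite -[_ == _]negbK w0.
Qed.

Lemma eq_qform h f g : f =1 g -> qform h f = qform h g.
Proof.
by move=> fg; apply: eq_bigr => x _; apply: eq_bigr => y _; rewrite !fg.
Qed.

Lemma lincomb0 k (F : 'I_k -> V -> C) h (w : 'I_k -> C) :
  (forall i, w i = 0) -> qform h (lincomb w F) = 0.
Proof.
move=> w0; apply: big1 => x _; apply: big1 => y _; rewrite {1}/lincomb big1 ?mul0r //.
by move=> i _; rewrite w0 mul0r.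
Qed.

Lemma positive_family_ge0 h k (F : 'I_k -> V -> C) w :
  positive_family h F -> 0 <= qform h (lincomb w F).
Proof.
move=> pF; have [/existsP w0|/existsPn w0] := boolP [exists i, w i != 0].
  exact/ltW/pF.
by rewrite lincomb0 // => i; apply/eqP; rewrite -[_ == _]negbK w0.
Qed.

Lemma positive_dim_extend h k (F : 'I_k -> V -> C) y :
    (forall w t, (exists i, w i != 0) \/ t != 0 ->
       0 < qform h (fun x => lincomb w F x + t * y x)) ->
  positive_dim h k.+1.
Proof.
move=> H; exists (fun i => oapp F y (unlift ord0 i)) => w [i wi].
rewrite (@eq_qform _ _ (fun x => lincomb (fun i => w (lift ord0 i)) F x + w ord0 * y x)).
  apply: H; case: (unliftP ord0 i) wi => [j ->|->] wi; last by right.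
  by left; exists j.
move=> x; rewrite /lincomb big_ord_recl unlift_none /= addrC; congr (_ + _).
by apply: eq_bigr => j _; rewrite liftK.
Qed.

Lemma positive_dim_hyperplane h k v : positive_dim h k.+1 ->
  exists2 F : 'I_k -> V -> C, (forall i, F i v = 0) & positive_family h F.
Proof.
case=> F pF.
have [i0 Fi0] : exists i0, forall i, F i0 v = 0 -> F i v = 0.
  have [i Fi|F0] := pickP (fun i => F i v != 0).
    by exists i => j Fi0; rewrite Fi0 eqxx in Fi.
  by exists ord0 => j _; apply/eqP; have := F0 j; case: eqP.
pose c j := F (lift i0 j) v / F i0 v.
exists (fun j x => F (lift i0 j) x - c j * F i0 x) => [j|w [j wj]].
  have [F0|F0] := eqVneq (F i0 v) 0; first by rewrite F0 mulr0 subr0 Fi0.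
  by rewrite /c divfK // subrr.
pose w' i := oapp w (- \sum_j w j * c j) (unlift i0 i).
rewrite (@eq_qform _ _ (lincomb w' F)); first by apply: pF; exists (lift i0 j);
  rewrite /w' liftK.
move=> x; rewrite /lincomb (bigD1_ord i0) //= /w' unlift_none /= mulNr.
rewrite mulr_suml addrC -sumrB.
by apply: eq_bigr => i _; rewrite liftK mulrBr mulrA.
Qed.

Lemma qform_translate h f y t : hermitian_kernel h ->
  let b := \sum_z (\sum_x y x * h x z) * (f z)^* in
  let q := \sum_z (\sum_x y x * h x z) * (y z)^* in
  qform h (fun x => f x + t * y x)
    = qform h f + (t * b + (t * b)^*) + t * t^* * q.
Proof.
move=> hh /=.
have bE g : \sum_z (\sum_x y x * h x z) * (g z)^*
    = \sum_x \sum_z y x * h x z * (g z)^*.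
  by rewrite exchange_big /=; apply: eq_bigr => z _; rewrite mulr_suml.
have -> : (t * \sum_z (\sum_x y x * h x z) * (f z)^*)^*
    = \sum_x \sum_z t^* * (f x * h x z * (y z)^*).
  rewrite bE exchange_big /= rmorphM rmorph_sum mulr_sumr; apply: eq_bigr => x _.
  rewrite rmorph_sum mulr_sumr; apply: eq_bigr => z _.
  by rewrite !rmorphM /= conjCK -hh; ring.
rewrite !bE !mulr_sumr -!big_split /=; apply: eq_bigr => x _.
rewrite !mulr_sumr -!big_split /=; apply: eq_bigr => z _.
by rewrite rmorphD rmorphM /=; ring.
Qed.

End Forms.

Section MaskedForms.

Variables (C : numClosedFieldType) (V : finType) (h : V -> V -> C).
Hypotheses (hh : hermitian_kernel h) (h1 : forall x y, h x y * h y x = 1).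
Implicit Types (e : rel V) (f g : V -> C).

Definition masked e x y := if e x y then h x y else 0.

Definition inertia e := form_inertia (masked e).

Lemma masked_hermitian e : symmetric e -> hermitian_kernel (masked e).
Proof.
by move=> es x y; rewrite /masked es; case: (e x y); rewrite ?conjC0.
Qed.

Lemma inertia0 e : (forall x y, ~~ e x y) -> inertia e = 0%N.
Proof.
move=> e0; apply/eqP; rewrite -leqn0 leqNgt; apply/negP => i0.
have es : symmetric e by move=> x y; rewrite !(negbTE (e0 _ _)).
have [F pF] := positive_dim_inertia (masked_hermitian es).
have : 0 < qform (masked e) (lincomb (fun=> 1) F).
  by apply: pF; exists (Ordinal i0); rewrite oner_eq0.
rewrite /qform big1 ?ltxx // => x _; rewrite big1 // => y _.
by rewrite /masked (negbTE (e0 x y)) mulr0 mul0r.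
Qed.

Lemma qform_vdel1 e f v : f v = 0 ->
  qform (masked (vdel e [set v])) f = qform (masked e) f.
Proof.
move=> fv; apply: eq_bigr => x _; apply: eq_bigr => y _.
rewrite /masked /vdel !inE; case: (e x y) => //=.
by case: eqVneq => [->|_]; last case: eqVneq => [->|_]; rewrite ?fv ?conjC0 ?mul0r ?mulr0.
Qed.

Lemma inertia_vdel1 e v : symmetric e ->
  (inertia e <= (inertia (vdel e [set v])).+1)%N.
Proof.
move=> es; have := positive_dim_inertia (masked_hermitian es).
rewrite -/(inertia e); case: (inertia e) => // k /(positive_dim_hyperplane v)[F Fv pF].
rewrite ltnS; apply: positive_dim_leq.
  by apply: masked_hermitian => x y; rewrite /vdel es [(x \notin _) && _]andbC.
exists F => w /pF; rewrite qform_vdel1 // /lincomb big1 // => i _.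
by rewrite Fv mulr0.
Qed.

Lemma qform_split e f v : simple_graph e ->
  let S := \sum_x f x * masked e x v in
  qform (masked e) f
    = qform (masked (vdel e [set v])) f + (S * (f v)^* + f v * S^*).
Proof.
move=> [es ei] /=; rewrite mulr_suml rmorph_sum mulr_sumr.
have -> : \sum_x f x * masked e x v * (f v)^*
    = \sum_x \sum_y (if y == v then f x * masked e x v * (f v)^* else 0).
  by apply: eq_bigr => x _; rewrite -big_mkcond big_pred1_eq.
have -> : \sum_x f v * (f x * masked e x v)^*
    = \sum_x \sum_y (if x == v then f v * (f y * masked e y v)^* else 0).
  rewrite exchange_big /=; apply: eq_bigr => x _.
  by rewrite -big_mkcond big_pred1_eq.
rewrite -!big_split /=; apply: eq_bigr => x _; rewrite -!big_split /=.
apply: eq_bigr => y _; rewrite rmorphM /= -(masked_hermitian es).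
rewrite /masked /vdel !inE.
case: (eqVneq x v) => [->|xv]; case: (eqVneq y v) => [->|yv]; rewrite ?ei ?andbF ?andbT;
  by rewrite ?mulr0 ?mul0r ?add0r ?addr0 // mulrCA mulrC.
Qed.

Lemma inertia_pendant e u v : simple_graph e -> pendant e u v ->
  ((inertia (vdel e [set v])).+1 <= inertia e)%N.
Proof.
move=> se [euv uv]; have [es ei] := se.
have uv0 : u != v by apply: contraTneq euv => ->; rewrite ei.
have [es' _] := simple_vdel [set v] se.
have [F pF] := positive_dim_inertia (masked_hermitian es').
apply: positive_dim_leq (masked_hermitian es) _.
pose L f := \sum_(x | (x != u) && (x != v)) f x * masked e x v.
pose F' i x := if x == v then 0 else if x == u then - L (F i) * h v u else F i x.
pose y x : C := if x == v then 1 else if x == u then h v u else 0.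
apply: (positive_dim_extend (F := F') (y := y)) => w t wt.
set f := lincomb w F; set g := fun x => _.
have gE x : x != u -> x != v -> g x = f x.
  move=> xu xv; rewrite /g /y /f /lincomb /F' (negbTE xu) (negbTE xv) mulr0 addr0.
  by [].
have gv : g v = t.
  rewrite /g /y /lincomb /F' eqxx mulr1 big1 ?add0r // => i _.
  by rewrite mulr0.
have LE : L f = \sum_i w i * L (F i).
  rewrite /L /f /lincomb; under eq_bigr => x _ do rewrite mulr_suml.
  rewrite exchange_big /=; apply: eq_bigr => i _; rewrite mulr_sumr.
  by apply: eq_bigr => x _; rewrite mulrA.
have gu : g u = (t - L f) * h v u.
  rewrite /g /y /lincomb /F' eqxx (negbTE uv0) addrC mulrBl; congr (_ + _).
  by rewrite LE mulr_suml -sumrN; apply: eq_bigr => i _; ring.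
have S : \sum_x g x * masked e x v = t.
  rewrite (bigD1 u) //= (bigID (pred1 v)) /= (big_pred1 v) => [|x]; last first.
    by rewrite andbC /=; case: (eqVneq x v) => //= ->; rewrite eq_sym uv0.
  rewrite gu /masked euv -mulrA h1 mulr1 ei mulr0 add0r.
  rewrite (eq_bigr (fun x => f x * masked e x v)) => [|x /andP[xu xv]].
    by rewrite -/(L f) subrK.
  by rewrite gE.
rewrite (qform_split g v se) /= S gv.
have -> : qform (masked (vdel e [set v])) g = qform (masked (vdel e [set v])) f.
  apply: eq_bigr => x _; apply: eq_bigr => z _; rewrite /masked.
  case: ifP => [/and3P[exz]|]; last by rewrite !mulr0 !mul0r.
  rewrite !inE => xv zv; rewrite !gE //.
    by apply: contraNneq xv => zu; apply/eqP/uv; rewrite -zu es.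
  by apply: contraNneq zv => xu; apply/eqP/uv; rewrite -xu.
have tt : 0 <= t * t^* + t * t^* by rewrite -normCK addr_ge0 ?exprn_ge0.
case: wt => [w0|t0]; first by apply: ltr_pwDl => //; apply: pF.
apply: ltr_wpDl; first exact: positive_family_ge0 pF.
by rewrite -normCK addr_gt0 ?exprn_gt0 ?normr_gt0.
Qed.

Lemma inertia_vector_geq e v y : simple_graph e -> y v = 1 ->
    (forall z, z != v -> \sum_x y x * masked e x z = 0) ->
    0 < \sum_x y x * masked e x v ->
  ((inertia (vdel e [set v])).+1 <= inertia e)%N.
Proof.
move=> se yv y0 s0; have [es ei] := se.
have [es' _] := simple_vdel [set v] se.
have [F pF] := positive_dim_inertia (masked_hermitian es').
apply: positive_dim_leq (masked_hermitian es) _.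
pose F' i x := if x == v then 0 else F i x.
apply: (positive_dim_extend (F := F') (y := y)) => w t wt.
have bE f : \sum_z (\sum_x y x * masked e x z) * (f z)^*
    = (\sum_x y x * masked e x v) * (f v)^*.
  by rewrite (bigD1 v) //= [X in _ + X]big1 ?addr0 // => z /y0 ->; rewrite mul0r.
have F'v : lincomb w F' v = 0.
  by rewrite /lincomb big1 // => i _; rewrite /F' eqxx mulr0.
rewrite qform_translate; last exact: masked_hermitian.
rewrite !bE F'v yv conjC0 conjC1 !mulr0 conjC0 !addr0 mulr1.
rewrite -(qform_vdel1 _ F'v).
have -> : qform (masked (vdel e [set v])) (lincomb w F')
    = qform (masked (vdel e [set v])) (lincomb w F).
  apply: eq_bigr => x _; apply: eq_bigr => z _; rewrite /masked.
  case: ifP => [/and3P[exz]|]; last by rewrite !mulr0 !mul0r.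
  by rewrite !inE => xv zv; rewrite /lincomb /F' (negbTE xv) (negbTE zv).
case: wt => [w0|t0].
  apply: ltr_pwDl; first exact: pF.
  by rewrite -normCK mulr_ge0 ?exprn_ge0 // ltW.
apply: ltr_wpDl; first exact: positive_family_ge0 pF.
by rewrite -normCK mulr_gt0 ?exprn_gt0 ?normr_gt0.
Qed.

Lemma inertia_vector_leq e v y : simple_graph e -> y v = 1 ->
    (forall z, z != v -> \sum_x y x * masked e x z = 0) ->
    \sum_x y x * masked e x v <= 0 ->
  (inertia e <= inertia (vdel e [set v]))%N.
Proof.
move=> se yv y0 s0; have [es ei] := se.
have [es' _] := simple_vdel [set v] se.
have [F pF] := positive_dim_inertia (masked_hermitian es).
apply: positive_dim_leq (masked_hermitian es') _.
have bE f : \sum_z (\sum_x y x * masked e x z) * (f z)^*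
    = (\sum_x y x * masked e x v) * (f v)^*.
  by rewrite (bigD1 v) //= [X in _ + X]big1 ?addr0 // => z /y0 ->; rewrite mul0r.
exists (fun i x => F i x - F i v * y x) => w w0.
set g := lincomb w _; set f := lincomb w F.
have gE x : f x = g x + f v * y x.
  rewrite /f /g /lincomb mulr_suml -big_split /=.
  by apply: eq_bigr => i _; ring.
have gv : g v = 0 by apply: (addIr (f v)); rewrite add0r [RHS]gE yv mulr1.
rewrite qform_vdel1 //; apply: lt_le_trans (pF w w0) _; rewrite -/f.
rewrite (eq_qform _ gE) qform_translate; last exact: masked_hermitian.
rewrite !bE gv yv conjC0 conjC1 !mulr0 conjC0 !addr0 mulr1 gerDl.
by rewrite -normCK mulr_ge0_le0 ?exprn_ge0.
Qed.

End MaskedForms.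

Section CycleInertia.

Variables (C : numClosedFieldType) (V : finType) (h : V -> V -> C).
Hypotheses (hh : hermitian_kernel h) (h1 : forall x y, h x y * h y x = 1).
Implicit Types (e : rel V) (s t p : seq V).

Definition cycle_weight s := \prod_(a <- s) h a (next s a).

Definition good_cycle s := odd (size s) /\
  0 < (-1) ^+ (size s)./2 * (cycle_weight s + (cycle_weight s)^*).

Lemma sum_two (F : V -> C) b c : b != c ->
  (forall a, a != b -> a != c -> F a = 0) -> \sum_a F a = F b + F c.
Proof.
move=> bc F0; rewrite (bigD1 b) //= (bigD1 c) ?[c == b]eq_sym //=.
by rewrite [X in _ + (_ + X)]big1 ?addr0 // => a /andP[]; apply: F0.
Qed.

Lemma next_nth_cons x p i : uniq (x :: p) -> (i < size (x :: p))%N ->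
  next (x :: p) (nth x (x :: p) i) = nth x (x :: p) i.+1.
Proof. by move=> up ip; rewrite next_nth mem_nth // index_uniq. Qed.

(* The vector is 1 at [x] and is determined by the orthogonality to the other
   vertices of the cycle: the coordinates of even index propagate forwards from
   [x], those of odd index backwards. *)
Lemma cycle_vector e x p : simple_graph e -> lone_cycle e (x :: p) ->
    closed_in e (x :: p) -> odd (size (x :: p)) ->
  exists y : V -> C, [/\ y x = 1,
    forall z, z != x -> \sum_a y a * masked h e a z = 0 &
    \sum_a y a * masked h e a x = (-1) ^+ (size (x :: p))./2
      * (cycle_weight (x :: p) + (cycle_weight (x :: p))^*)].
Proof.
set s := x :: p; move=> se ls cls os; have [es ei] := se; have [cs _] := ls.
have /and3P[s3 us _] := cs; pose q := size s; pose c i := nth x s i.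
have c0 : c 0%N = x by [].
have cq : c q = x by rewrite /c nth_default.
have cne i j : (i < q)%N -> (j < q)%N -> (c i == c j) = (i == j).
  by move=> iq jq; rewrite nth_uniq.
have nc i : (i < q)%N -> next s (c i) = c i.+1 by exact: next_nth_cons.
have ec i : (i < q)%N -> e (c i) (c i.+1).
  by move=> iq; rewrite -nc //; apply: is_cycle_next cs _; rewrite mem_nth.
pose Y j : C := if odd j then (-1) ^+ ((q - j)./2) * \prod_(j <= i < q) h (c i.+1) (c i)
  else (-1) ^+ (j./2) * \prod_(0 <= i < j) h (c i) (c i.+1).
have YS j : (j.+2 <= q)%N ->
    Y j * h (c j) (c j.+1) + Y j.+2 * h (c j.+2) (c j.+1) = 0.
  move=> jq; rewrite /Y /= negbK; case: ifP => oj.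
    have -> : (q - j = (q - j.+2).+2)%N by lia.
    rewrite /= (@big_ltn _ _ _ j) ?(@big_ltn _ _ _ j.+1) //; try lia.
    set w := \prod_(_ <= i < _) _; rewrite exprS mulN1r; move: (_ ^+ _) => sg.
    have := h1 (c j) (c j.+1).
    move: (h (c j) _) (h (c j.+1) (c j)) (h (c j.+2) _) => k l m kl.
    by rewrite -[X in _ + X]mulr1 -kl; ring.
  rewrite !big_nat_recr //= exprS mulN1r; set w := \prod_(_ <= i < _) _.
  move: (_ ^+ _) => sg.
  have := h1 (c j.+1) (c j.+2).
  move: (h (c j) _) (h (c j.+1) _) (h (c j.+2) _) => k l m kl.
  by rewrite -[X in X + _]mulr1 -kl; ring.
have Y0 : Y 0%N = 1 by rewrite /Y /= big_geq // mulr1.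
have Yq : Y q = 1 by rewrite /Y os subnn /= big_geq // mulr1.
pose y z := if z \in s then Y (index z s) else 0.
have yc i : (i <= q)%N -> y (c i) = Y i.
  rewrite leq_eqVlt => /predU1P[->|iq]; first by rewrite cq Yq /y /s /= inE !eqxx Y0.
  by rewrite /y mem_nth // index_uniq.
have maskc i : (i < q)%N -> masked h e (c i) (c i.+1) = h (c i) (c i.+1) /\
    masked h e (c i.+1) (c i) = h (c i.+1) (c i).
  by move=> iq; rewrite /masked [e (c i.+1) _]es ec.
have nbr a j : (j < q)%N -> e a (c j) ->
    a = c j.+1 \/ a = c (if j is i.+1 then i else q.-1).
  move=> jq eac; have cj : c j \in s by rewrite mem_nth.
  have as_ : a \in s by apply: cls cj _; rewrite es.
  have [cn|an] := lone_cycle_chord se ls as_ cj eac; last first.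
    by left; rewrite an nc.
  right; move: cn; have iq := as_; rewrite -index_mem in iq.
  rewrite -(nth_index x as_) -/(c _) nc //; move: (index a s) iq => i iq.
  have [iq'|iq'] := ltnP i.+1 q.
    by move=> /eqP; rewrite cne // => /eqP->.
  have -> : i.+1 = q by apply/eqP; rewrite eqn_leq iq iq'.
  rewrite cq -c0 => /eqP; rewrite cne // => /eqP->.
  by congr (c _); move: iq iq'; rewrite -/q; move: (q) => k; lia.
have sumE j b : (j < q)%N -> b = (if j is i.+1 then i else q.-1) ->
    \sum_a y a * masked h e a (c j)
      = y (c b) * masked h e (c b) (c j) + y (c j.+1) * masked h e (c j.+1) (c j).
  move=> jq bE; rewrite (@sum_two _ (c b) (c j.+1)) //.
    have bq : (b < q)%N by rewrite bE; case: (j) jq => [|i]; rewrite /q; lia.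
    have [jq'|jq'] := ltnP j.+1 q.
      by rewrite cne // bE; case: (j) jq => [|i]; rewrite /q; lia.
    have -> : j.+1 = q by lia.
    by rewrite cq -c0 cne // bE; case: (j) jq' => [|i]; rewrite /q; lia.
  move=> a ab aj; rewrite /masked; case: ifP => [/(nbr _ _ jq)|]; last by rewrite mulr0.
  by rewrite -bE => -[] aE; [rewrite aE eqxx in aj|rewrite aE eqxx in ab].
exists y; split; first by rewrite -c0 yc.
  move=> z zx; have [zs|zs] := boolP (z \in s); last first.
    apply: big1 => a _; rewrite /masked /y; case: ifP => as_; last by rewrite mul0r.
    by case: ifP => [/(cls _ _ as_)|]; rewrite ?mulr0 // (negbTE zs).
  have := zx; rewrite -(nth_index x zs) -/(c _).
  have := zs; rewrite -index_mem -/q; case: (index z s) => [|j] jq.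
    by rewrite c0 eqxx.
  move=> _; rewrite (sumE _ j) // !yc //; last by lia.
  have [-> _] := maskc j (ltnW jq); have [_ ->] := maskc j.+1 jq.
  exact: YS.
transitivity (y (c q.-1) * masked h e (c q.-1) (c 0%N)
    + y (c 1%N) * masked h e (c 1%N) (c 0%N)); first exact: (sumE 0%N q.-1).
have qE : q.-1.+1 = q by rewrite prednK.
have -> : masked h e (c q.-1) (c 0%N) = h (c q.-1) (c q.-1.+1).
  by have [<- _] := maskc q.-1 (leqnn _); rewrite qE cq.
have [_ ->] := maskc 0%N (ltnW (ltnW s3)).
have WE : cycle_weight s = \prod_(0 <= i < q) h (c i) (c i.+1).
  by rewrite /cycle_weight (big_nth x); apply: eq_big_nat => i /andP[_ iq]; rewrite nc.
have WC : (cycle_weight s)^* = \prod_(0 <= i < q) h (c i.+1) (c i).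
  by rewrite WE rmorph_prod; apply: eq_bigr => i _ /=; rewrite -hh.
rewrite !yc ?leq_pred //.
rewrite WC WE /Y /= (_ : odd q.-1 = false); last by move: os; rewrite -/q; lia.
have -> : \prod_(0 <= i < q) h (c i) (c i.+1)
    = \prod_(0 <= i < q.-1) h (c i) (c i.+1) * h (c q.-1) (c q.-1.+1).
  by rewrite -{1}qE big_nat_recr.
have -> : \prod_(0 <= i < q) h (c i.+1) (c i)
    = h (c 1%N) (c 0%N) * \prod_(1 <= i < q) h (c i.+1) (c i).
  by rewrite big_ltn.
rewrite -/q (_ : (q.-1./2 = q./2)%N); last by move: os; rewrite -/q; lia.
rewrite (_ : ((q - 1)./2 = q./2)%N); last by move: os; rewrite -/q; lia.
ring.
Qed.

End CycleInertia.

(** * Extremal graphs *)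

Section Extremal.

Variables (C : numClosedFieldType) (V : finType) (h : V -> V -> C).
Hypotheses (hh : hermitian_kernel h) (h1 : forall x y, h x y * h y x = 1).
Implicit Types (e : rel V) (s t p : seq V) (S : {set V}).

Lemma cyclomatic0 e : (forall x y, ~~ e x y) -> cyclomatic_number e = 0.
Proof.
move=> e0; rewrite /cyclomatic_number; have -> : edge_set e = set0.
  apply/setP=> B; rewrite in_set0; apply/negP=> /edge_setP[x [y [exy _]]].
  by have := e0 x y; rewrite exy.
have -> : components e = #|V|.
  apply: eq_card => x; rewrite !inE andbT /roots.
  have /connectP[[|y p] /= pp ->] := connect_root e x; first exact: eqxx.
  by have := e0 x y; case/andP: pp => ->.
by rewrite cards0 sub0r addNr.
Qed.

Lemma inertia_leq e : simple_graph e ->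
  (inertia h e)%:Z <= (matching_number e)%:Z + cyclomatic_number e.
Proof.
have [n] := ubnP #|non_isolated e|; elim: n e => // n IH e en se.
have IHd (S : {set V}) x y : x \in S -> e x y -> (inertia h (vdel e S))%:Z <=
    (matching_number (vdel e S))%:Z + cyclomatic_number (vdel e S).
  move=> xS exy; apply: IH; last exact: simple_vdel.
  exact: leq_trans (card_non_isolated_vdel xS exy) _.
have [[x y] /= exy|e0] := pickP (fun z : V * V => e z.1 z.2); last first.
  have {}e0 x y : ~~ e x y by have /= -> := e0 (x, y).
  by rewrite inertia0 // matching_number0 // cyclomatic0.
have [[u v] /= /andP[euv /forallP uv]|np] :=
    pickP (fun z : V * V => e z.1 z.2 && [forall t, e z.1 t ==> (t == z.2)]).
  have puv : pendant e u v.
    by split=> // z euz; apply/eqP; have := uv z; rewrite euz.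
  have := matching_number_pendant (proj1 se) puv.
  have := inertia_vdel1 hh v (proj1 se).
  have := cyclomatic_vdel [set v] se.
  have /IHd/(_ (_ : e v u)) := set11 v; rewrite (proj1 se) => /(_ euv).
  move: (inertia h e) (inertia h _) (matching_number e) (matching_number _) => a b c d.
  by move: (cyclomatic_number e) (cyclomatic_number _) => k l; lia.
have np' u v : ~ pendant e u v.
  move=> [euv uv]; have /negP := negbT (np (u, v)); apply => /=.
  by rewrite euv; apply/forallP=> t; apply/implyP=> /uv->.
have [[|z s] cs] := cycle_exists se exy np'; first by case/andP: cs.
have zs : z \in z :: s by rewrite mem_head.
have := matching_number_vdel e [set z].
have := inertia_vdel1 hh z (proj1 se).
have := cyclomatic_vdel_cyclic se cs zs.
have := IHd _ _ _ (set11 z) (is_cycle_next cs zs).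
move: (inertia h e) (inertia h _) (matching_number e) (matching_number _) => a b c d.
by move: (cyclomatic_number e) (cyclomatic_number _) => k l; lia.
Qed.

Definition isolated_path e p := [/\ uniq p, sorted e p &
  forall z w, z \in p -> e z w ->
    w \in p /\ (index w p = (index z p).+1 \/ index z p = (index w p).+1)].

Lemma set_cons x p : [set z in x :: p] = [set x] :|: [set z in p].
Proof. by apply/setP=> z; rewrite !inE. Qed.

Lemma sorted_vdel e S p : [disjoint p & S] -> sorted e p -> sorted (vdel e S) p.
Proof.
move=> dp; apply: (sub_in_sorted (P := [in p])); last exact: allss.
by move=> x y xp yp exy; rewrite /vdel exy !(disjointFr dp).
Qed.

Lemma inertia_isolated_path e p : simple_graph e -> isolated_path e p ->
  inertia h e = (inertia h (vdel e [set x in p]) + (size p)./2)%N.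
Proof.
have [n] := ubnP (size p); elim: n e p => // n IH e [|a [|b p]] /= sp se [up pp ip].
- by rewrite (_ : [set _ in _] = set0) ?vdel0 ?addn0 //; apply/setP=> x; rewrite !inE.
- rewrite addn0 set_cons (_ : [set _ in [::]] = set0); last first.
    by apply/setP=> x; rewrite !inE.
  rewrite setU0 vdel_isolated //; first by case: se.
  move=> y; apply/negP=> /(ip _ _ (mem_head _ _))[].
  by rewrite inE => /eqP->; rewrite /= eqxx; case.
have [es ei] := se; have /and3P[] := up; rewrite inE negb_or => /andP[ab ap] bp up'.
have /andP[eab ebp] := pp.
have pab : pendant e a b.
  split=> // z /(ip _ _ (mem_head _ _))[]; rewrite /= eqxx.
  rewrite ![_ == z]eq_sym; case: (eqVneq z a) => [->|_] _; first by case.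
  by case: (eqVneq z b) => // _ [].
have -> : inertia h e = (inertia h (vdel e [set b])).+1.
  by apply/eqP; rewrite eqn_leq inertia_vdel1 // (inertia_pendant hh h1 se pab).
rewrite (IH (vdel e [set b]) p) //; first last.
- split=> //.
    apply: sorted_vdel; last exact: path_sorted ebp.
    by rewrite disjoint_subset; apply/subsetP=> x xp; rewrite !inE;
      apply: contraTneq xp => ->.
  move=> z w zp /and3P[ezw]; rewrite !inE => zb wb.
  have za : z != a by apply: contraTneq zp => ->.
  have := ip z w; rewrite !inE zp !orbT (negbTE wb) => /(_ isT ezw) [].
  rewrite /= ![a == _]eq_sym ![b == _]eq_sym (negbTE za) (negbTE zb) (negbTE wb).
  case: eqP => [_ _ []//|_ /= wp [][]] E; split=> //; by auto.
- exact: simple_vdel.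
- exact: ltnW.
rewrite -addnS -(pendant_vdel es pab) vdelU; congr (inertia h (vdel e _) + _)%N.
by apply/setP=> x; rewrite !inE orbA.
Qed.

Lemma leaf_isolated_path e x p : simple_graph e -> leaf_cycle e x p ->
  isolated_path (vdel e [set x]) p.
Proof.
move=> se [ls lc]; have [cs _] := ls; have /and3P[s3 us cyc] := cs.
have /andP[xp up] := us; split=> //.
  apply: sorted_vdel.
    by rewrite disjoint_subset; apply/subsetP=> z zp; rewrite !inE;
      apply: contraTneq zp => ->.
  by move: cyc; rewrite /= rcons_path => /andP[/path_sorted].
move=> z w zp /and3P[ezw]; rewrite !inE => zx wx.
have zs : z \in x :: p by rewrite inE zp orbT.
have ws : w \in x :: p.
  case: lc => [cls|[y [_ _ H]]]; first exact: cls ezw.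
  by apply/negPn/negP => ws; have [/eqP] := H _ _ zs ws ezw; rewrite (negbTE zx).
have wp : w \in p by move: ws; rewrite inE (negbTE wx).
have ix a b : a \in p -> b \in p -> b = next (x :: p) a -> index b p = (index a p).+1.
  move=> ap bp; rewrite next_nth inE ap orbT /=.
  have -> : (x == a) = false by apply: contraNF xp => /eqP->.
  have [lt|ge] := ltnP (index a p).+1 (size p); first by move=> ->; rewrite index_uniq.
  by rewrite nth_default // => bx; rewrite bx (negbTE xp) in bp.
split=> //; have [E|E] := lone_cycle_chord se ls zs ws ezw.
  by left; apply: ix.
by right; apply: ix.
Qed.

Lemma matching_number_leaf e x p : simple_graph e -> leaf_cycle e x p ->
  (matching_number (vdel e [set x])
     <= matching_number (vdel e [set z in x :: p]) + (size p)./2)%N.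
Proof.
move=> se lc; have [up _ ip] := leaf_isolated_path se lc.
have [es ei] := simple_vdel [set x] se.
rewrite set_cons -vdelU -(card_uniqP up) -cardsE.
apply: matching_number_closed => // a b eab; rewrite !inE.
apply/idP/idP => [/ip/(_ eab)[]//|]; rewrite es in eab.
by move/ip=> /(_ _ eab)[].
Qed.

Definition extremal e :=
  (inertia h e)%:Z = (matching_number e)%:Z + cyclomatic_number e.

Lemma extremal_pendant e u v : simple_graph e -> extremal e -> pendant e u v ->
  ~~ on_cycle e v /\ extremal (vdel e [set v]).
Proof.
move=> se; rewrite /extremal => Ee puv.
have H1 := matching_number_pendant (proj1 se) puv.
have H2 := inertia_vdel1 hh v (proj1 se).
have H3 := inertia_leq (simple_vdel [set v] se).
have nv : ~~ on_cycle e v.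
  apply/negP=> /on_cycleP[s cs vs]; have := cyclomatic_vdel_cyclic se cs vs.
  move: Ee H1 H2 H3.
  move: (inertia h e) (inertia h _) (matching_number e) (matching_number _) => a b c d.
  by move: (cyclomatic_number e) (cyclomatic_number _) => k l; lia.
split=> //; have := cyclomatic_vdel [set v] se; move: Ee H1 H2 H3.
move: (inertia h e) (inertia h _) (matching_number e) (matching_number _) => a b c d.
by move: (cyclomatic_number e) (cyclomatic_number _) => k l; lia.
Qed.

Lemma extremal_disjoint e : simple_graph e -> extremal e -> cycles_disjoint e.
Proof.
move=> se; rewrite /extremal => Ee s t cs ct nst.
rewrite disjoint_subset; apply/subsetP=> z zs; rewrite !inE; apply/negP=> zt.
have [x [xs xt H]] := cycles_share_vertex cs ct nst zs zt.
have := inertia_leq (simple_vdel [set x] se).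
have := inertia_vdel1 hh x (proj1 se); have := matching_number_vdel e [set x].
have : cyclomatic_number (vdel e [set x]) <= cyclomatic_number e - 2.
  by case/orP: H => H; [apply: cyclomatic_vdel_two_cycles cs ct xs xt H |
     apply: cyclomatic_vdel_two_cycles ct cs xt xs H].
move: Ee.
move: (inertia h e) (inertia h _) (matching_number e) (matching_number _) => a b c d.
by move: (cyclomatic_number e) (cyclomatic_number _) => k l; lia.
Qed.

Lemma extremal_cyclic e s x : simple_graph e -> extremal e -> is_cycle e s ->
    x \in s ->
  [/\ extremal (vdel e [set x]), matching_number (vdel e [set x]) = matching_number e
    & inertia h e = (inertia h (vdel e [set x])).+1].
Proof.
move=> se; rewrite /extremal => Ee cs xs.
have := inertia_leq (simple_vdel [set x] se).
have := inertia_vdel1 hh x (proj1 se); have := matching_number_vdel e [set x].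
have := cyclomatic_vdel_cyclic se cs xs; move: Ee.
move: (inertia h e) (inertia h _) (matching_number e) (matching_number _) => a b c d.
by move: (cyclomatic_number e) (cyclomatic_number _) => k l; split; lia.
Qed.

Lemma leaf_sorted e x p S : leaf_cycle e x p -> [disjoint p & S] ->
  sorted (vdel e S) p /\ uniq p.
Proof.
case=> -[/and3P[_ us cyc] _] _ dp; split; last by case/andP: us.
by apply: sorted_vdel => //; move: cyc; rewrite /= rcons_path => /andP[/path_sorted].
Qed.

Lemma leaf_disjoint1 e x p : leaf_cycle e x p -> [disjoint p & [set x]].
Proof.
case=> -[/and3P[_ /andP[xp _] _] _] _; rewrite disjoint_subset.
by apply/subsetP=> z zp; rewrite !inE; apply: contraTneq zp => ->.
Qed.

Lemma extremal_leaf e x p : simple_graph e -> extremal e -> leaf_cycle e x p ->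
  extremal (vdel e [set z in x :: p]).
Proof.
move=> se Ee lc; have cs : is_cycle e (x :: p) by case: lc => -[].
have [Ex mx _] := extremal_cyclic se Ee cs (mem_head _ _).
have sx := simple_vdel [set x] se.
have Ip := inertia_isolated_path sx (leaf_isolated_path se lc).
have [pp up] := leaf_sorted lc (leaf_disjoint1 lc).
have Mp := matching_number_path up pp.
have Cp := cyclomatic_vdel [set z in p] sx.
have := inertia_leq (simple_vdel [set z in p] sx).
move: Ex Ip Mp Cp; rewrite set_cons -vdelU /extremal.
move: (inertia h _) (inertia h _) (matching_number _) (matching_number _) => a b c d.
by move: (cyclomatic_number _) (cyclomatic_number _) (_./2) => k l n; lia.
Qed.

Lemma extremal_attached e x p y : simple_graph e -> extremal e ->
    leaf_cycle e x p -> e x y -> y \notin x :: p ->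
  ~ missable (vdel e [set z in x :: p]) y.
Proof.
move=> se Ee lc exy yp [my _]; have cs : is_cycle e (x :: p) by case: lc => -[].
have [Ex mx _] := extremal_cyclic se Ee cs (mem_head _ _).
have Mx := matching_number_leaf se lc.
have dxy : [disjoint p & [set x; y]].
  rewrite disjoint_subset; apply/subsetP=> z zp; rewrite !inE negb_or.
  have := disjointFr (leaf_disjoint1 lc) zp; rewrite inE => -> /=.
  by apply: contraNneq yp => <-; rewrite inE zp orbT.
have [pp up] := leaf_sorted lc dxy.
have Mp := matching_number_path up pp.
have Mxy := matching_number_add_edge exy.
have E : vdel (vdel e [set x; y]) [set z in p] = vdel (vdel e [set z in x :: p]) [set y].
  by rewrite !vdelU set_cons; congr (vdel e _); rewrite setUAC.
by move: mx Mx Mp Mxy my; rewrite E; lia.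
Qed.

Lemma cycle_sign_real s :
  (-1) ^+ (size s)./2 * (cycle_weight h s + (cycle_weight h s)^*) \is Num.real.
Proof.
rewrite realM ?realX ?realN ?real1 // CrealE rmorphD /= conjCK addrC.
exact: eqxx.
Qed.

Lemma extremal_good e s : simple_graph e -> extremal e -> lone_cycle e s ->
  closed_in e s -> good_cycle h s.
Proof.
case: s => [|x p]; first by move=> _ _ [/andP[]].
move=> se Ee ls cls; have cs : is_cycle e (x :: p) by case: ls.
have lc : leaf_cycle e x p by split=> //; left.
have [Ex mx ix] := extremal_cyclic se Ee cs (mem_head _ _).
have os : odd (size (x :: p)).
  have Mx := matching_number_leaf se lc; have /and3P[_ us _] := cs.
  have := matching_number_path us (cycle_sorted cs).
  by move: mx Mx => /=; lia.
split=> //; rewrite real_ltNge ?real0 ?cycle_sign_real //; apply/negP=> s0.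
have [y [yx y0 ys]] := cycle_vector hh h1 se ls cls os.
by have := inertia_vector_leq hh se yx y0; rewrite ys ix ltnn => /(_ s0).
Qed.

Lemma extremal_reducible e : simple_graph e -> extremal e ->
  reducible (good_cycle h) e.
Proof.
apply: (@reducible_of V (good_cycle h) _ extremal); first by move=> s [].
- exact: extremal_pendant.
- exact: extremal_disjoint.
- exact: extremal_leaf.
- exact: extremal_attached.
- exact: extremal_good.
Qed.

Lemma reducible_extremal e : simple_graph e -> reducible (good_cycle h) e ->
  extremal e.
Proof.
move=> se re; apply/eqP; rewrite eq_le inertia_leq //=.
elim: re se => {e} [e e0|e u v puv nv re IH|e [|x p] ls cls gs re IH] se.
- by rewrite inertia0 // matching_number0 // cyclomatic0.
- have := IH (simple_vdel _ se).
  have := matching_number_vdel_geq e [set v]; rewrite cards1.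
  have := inertia_pendant hh h1 se puv.
  rewrite (cyclomatic_vdel_noncyclic se) => [|x /set1P->//].
  move: (inertia h e) (inertia h _) (matching_number e) (matching_number _) => a b c d.
  by move: (cyclomatic_number e) => k; lia.
- by case: ls => /andP[].
have cs : is_cycle e (x :: p) by case: ls.
have lc : leaf_cycle e x p by split=> //; left.
have [os s0] := gs _ cs erefl.
have [y [yx y0 ys]] := cycle_vector hh h1 se ls cls os.
have := inertia_vector_geq hh se yx y0; rewrite ys => /(_ s0).
rewrite (inertia_isolated_path (simple_vdel _ se) (leaf_isolated_path se lc)).
have := matching_number_lone_cycle (proj2 se) cls (proj1 se) _ os.
have /and3P[_ us _] := cs; move/(_ us).
have := cyclomatic_closed_cycle se ls cls.
have := IH (simple_vdel _ se); rewrite set_cons -!vdelU /=.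
move: (inertia h e) (inertia h _) (matching_number e) (matching_number _) => a b c d.
by move: (cyclomatic_number e) (cyclomatic_number _) (_./2) => k l n; lia.
Qed.

End Extremal.

Section MixedGraphs.

Variables (C : numClosedFieldType) (V : finType) (G : mixed_graph V).

(* Weights of modulus 1 everywhere, so that no hypothesis ties the weights to
   the subgraphs in the induction. *)
Definition unit_weight x y : C := if edge G x y then hermitian_entry G C x y else 1.

Lemma unit_weight_hermitian : hermitian_kernel unit_weight.
Proof.
move=> x y; rewrite /unit_weight edge_sym; case: ifP => [exy|_]; last by rewrite conjC1.
rewrite /hermitian_entry edge_sym exy.
case axy: (Defs.arc G x y); first by rewrite (negbTE (arc_asym axy)) conjCi.
by case: (Defs.arc G y x); rewrite ?rmorphN /= ?conjCi ?opprK ?conjC1.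
Qed.

Lemma unit_weight_unit x y : unit_weight x y * unit_weight y x = 1.
Proof.
rewrite [X in _ * X]unit_weight_hermitian -normCK /unit_weight /hermitian_entry.
case: (edge G x y); last by rewrite normr1 expr1n.
by case: (Defs.arc G x y); case: (Defs.arc G y x);
  rewrite ?normrN ?normCi ?normr1 ?expr1n.
Qed.

Lemma positive_inertiaE : positive_inertia G C = inertia unit_weight (edge G).
Proof.
rewrite /inertia /form_inertia; congr (count _ (eigenvalues _)).
apply/matrixP=> i j; rewrite !mxE /masked /unit_weight /hermitian_entry.
case exy: (edge G _ _) => //; case a1: (Defs.arc G _ _).
  by rewrite (arc_edge a1) in exy.
by case a2: (Defs.arc G _ _) => //; rewrite edge_sym (arc_edge a2) in exy.
Qed.

Lemma cycle_weightE s : is_cycle (edge G) s ->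
  let f := count (fun x => Defs.arc G x (next s x)) s in
  let b := count (fun x => Defs.arc G (next s x) x) s in
  cycle_weight unit_weight s = 'i ^+ f * (- 'i) ^+ b /\ (f + b <= size s)%N.
Proof.
move=> cs; have : {in s, forall x, edge G x (next s x)}.
  by move=> x; apply: is_cycle_next.
rewrite /cycle_weight; move: (next s) => nx {cs}.
elim: s => [|x s IH] es /=; first by rewrite big_nil mulr1.
have [|E le] := IH; first by move=> y ys; apply: es; rewrite inE ys orbT.
rewrite big_cons E /unit_weight es ?mem_head // /hermitian_entry.
case axy: (Defs.arc G x (nx x)).
  rewrite (negbTE (arc_asym axy)) !add0n add1n exprS mulrA; split=> //.
case: (Defs.arc G (nx x) x); rewrite ?add0n ?add1n.
  by rewrite exprS mulrCA addnS; split.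
by rewrite es ?mem_head // mul1r; split=> //; apply: leqW.
Qed.

End MixedGraphs.

Lemma sign_condition (C : numClosedFieldType) (m f b : nat) :
  (f + b <= m.*2.+1)%N -> let sigma := `|f%:Z - b%:Z|%N in
  (0 < (-1) ^+ m * ('i ^+ f * (- 'i) ^+ b + ('i ^+ f * (- 'i) ^+ b)^*) :> C)
  = ~~ odd sigma && (`|sigma%:Z - m.*2.+1%:Z|%N == 1 %[mod 4])%N.
Proof.
move=> fb sigma.
have ii : 'i * - 'i = 1 :> C by rewrite mulrN -expr2 sqrCi opprK.
have ii' : - 'i * 'i = 1 :> C by rewrite mulrC.
have -> : 'i ^+ f * (- 'i) ^+ b + ('i ^+ f * (- 'i) ^+ b)^*
    = 'i ^+ sigma + (- 'i) ^+ sigma :> C.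
  rewrite rmorphM !rmorphXn rmorphN /= conjCi opprK.
  have [lebf|/ltnW lefb] := leqP b f.
    have -> : sigma = (f - b)%N by rewrite /sigma; lia.
    by rewrite -{1 2}(subnK lebf) !exprD -!mulrA -!exprMn ii ii' !expr1n !mulr1.
  have -> : sigma = (b - f)%N by rewrite /sigma; lia.
  rewrite addrC -{1 2}(subnK lefb) !exprD.
  rewrite ![_ * ('i ^+ f)]mulrC ![_ * ((- 'i) ^+ f)]mulrC !mulrA -!exprMn.
  by rewrite ii ii' !expr1n !mul1r.
have sm : (sigma <= m.*2.+1)%N by rewrite /sigma; lia.
have [os|os] := boolP (odd sigma).
  rewrite -{1 2}[sigma]odd_double_half os /= add1n !exprS -!mul2n !exprM sqrrN.
  by rewrite mulNr subrr mulr0 ltxx.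
move: sigma os sm => sigma os; rewrite -(even_halfK os); move: sigma./2 => k km.
rewrite -!mul2n !exprM sqrrN sqrCi -mulr2n mulrnAr -exprD -signr_odd.
have -> : (`|(2 * k)%N%:Z - (2 * m).+1%:Z|%N == 1 %[mod 4])%N = ~~ odd (m + k).
  by apply/idP/idP; lia.
case: (odd _) => /=; last by rewrite expr0 ltr0n.
by rewrite expr1 mulNrn oppr_gt0 lt_gtF ?ltr0n.
Qed.

Theorem theorem3p9 (C : numClosedFieldType) (V : finType) (G : mixed_graph V)
    (hG : connected G) :
  (positive_inertia G C)%:Z
    = (matching_number (edge G))%:Z + cyclomatic_number (edge G)
  <->
  [/\ cycles_disjoint (edge G),
      forall s : seq V, is_cycle (edge G) s ->
        [/\ odd (size s), ~~ odd (signature G s)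
          & (`|(signature G s)%:Z - (size s)%:Z|%N = 1 %[mod 4])%N]
    & matching_number (contraction_edge (edge G))
      = matching_number (contraction_noncyclic (edge G))].
Proof.
pose h := unit_weight C G; set e := edge G.
have hh : hermitian_kernel h by exact: unit_weight_hermitian.
have h1 x y : h x y * h y x = 1 by exact: unit_weight_unit.
have se : simple_graph e by split; [exact: edge_sym | exact: edge_irr].
have goodE s : is_cycle e s -> good_cycle h s <->
    [/\ odd (size s), ~~ odd (signature G s)
      & (`|(signature G s)%:Z - (size s)%:Z|%N = 1 %[mod 4])%N].
  move=> cs; have [wE fb] := cycle_weightE C cs; rewrite /good_cycle wE.
  have [os|nos] := boolP (odd (size s)); last by split=> -[].
  have sE : size s = (size s)./2.*2.+1 by rewrite -{1}[size s]odd_double_half os.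
  rewrite sE in fb; rewrite sign_condition // -sE.
  by split=> [[_ /andP[nsig /eqP mod4]]|[_ nsig mod4]]; split=> //;
    rewrite nsig mod4 eqxx.
rewrite positive_inertiaE -/h -/e; split.
  move/(extremal_reducible hh h1 se)/(reducible_condition se)=> [de ge [S cS leS]].
  split=> // [s cs|]; first exact/goodE/ge.
  apply/eqP; rewrite eqn_leq; apply/andP; split.
    apply: leq_trans (matching_number_contraction_leq de cS) _.
    by rewrite matching_number_contraction_noncyclic.
  rewrite matching_number_contraction_noncyclic // -[cyclic_vertices e]setCK.
  exact/matching_number_contraction_geq/noncyclic_transversal.
case=> de ge me; apply: (reducible_extremal hh h1 se).
apply: condition_reducible => //; first by move=> s [].
split=> // [s cs|R tR]; first exact/goodE/ge.
rewrite -matching_number_contraction_noncyclic // -me.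
exact: matching_number_contraction_geq.
Qed.
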